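(* Let $A$ be an associative algebra over an algebraically closed field $\mathbb{F}$ of characteristic zero, and suppose $A$ admits nondegenerate regular gradings by finite (not necessarily abelian) groups $G$ and $H$. Then $|G|=|H|$ and this number equals $\exp(A)$. In particular $A$ is a PI-algebra.
   Context: For a group $G$ and $\bar g=(g_1,\dots,g_n)\in G^n$ let $Sym(\bar g)=\{\sigma\in Sym(n): g_1\cdots g_n=g_{\sigma(1)}\cdots g_{\sigma(n)}\}$. A $G$-grading $A=\bigoplus_{g\in G}A_g$ (with $A_gA_h\subseteq A_{gh}$) is regular, with commutation function $\theta$, if: (commutation) for every $n\geq 1$, $\bar g\in G^n$ and $\sigma\in Sym(\bar g)$ there is a scalar $\theta_{(\bar g,\sigma)}\in\mathbb{F}^\times$ such that $a_1\cdots a_n=\theta_{(\bar g,\sigma)}\,a_{\sigma(1)}\cdots a_{\sigma(n)}$ for all $a_i\in A_{g_i}$; (regularity) for every $n\geq 1$ and $\bar g\in G^n$ there are $a_i\in A_{g_i}$ with $a_1\cdots a_n\ne 0$. For commuting $g,h\in G$ write $\theta_{g,h}=\theta_{((g,h),(1\,2))}$. The grading is nondegenerate if for every $e\neq g\in G$ there is $g'\in C_G(g)$ (the centralizer) with $\theta_{g,g'}\ne 1$. $Id(A)$ is the T-ideal of polynomial identities of $A$; $A$ is PI if it satisfies a nonzero polynomial identity. With $P_n$ the $n!$-dimensional space of multilinear polynomials in $x_1,\dots,x_n$, put $c_n(A)=\dim_{\mathbb{F}}\big(P_n/(P_n\cap Id(A))\big)$; the exponent is $\exp(A)=\lim_{n\to\infty}c_n(A)^{1/n}$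 (for PI-algebras this limit exists and is a nonnegative integer, by Giambruno and Zaicev). *)

(* Defs.v *)
From HB Require Import structures.
From mathcomp Require Import all_boot all_order all_algebra all_fingroup.
From mathcomp Require Import all_classical all_reals all_analysis.
From mathcomp Require Import finmap.
From mathcomp.multinomials Require Import -(notations) monalg.

Set Implicit Arguments.
Unset Strict Implicit.
Unset Printing Implicit Defensive.

Import GRing.Theory numFieldNormedType.Exports.

Local Open Scope classical_set_scope.
Local Open Scope ring_scope.

(* An associative algebra over F, possibly without unit and possibly infinite
   dimensional, is an F-module A with an associative bilinear product mul;
   associativity is a separate hypothesis. *)

(* Noncommutative polynomials over F in the variables x_0, x_1, ... *)
Notation free_algebra F := (malg (fmonom nat) F).

Section Algebra.
Context (F : fieldType) (A : lmodType F) (mul : {bilinear A -> A -> A}).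

(* The value at the empty sequence is junk: A need not have a unit. *)
Definition mulseq (s : seq A) : A :=
  if s is x :: s' then foldl mul x s' else 0.

Section Grading.
Context (G : finGroupType).

Record is_grading (AG : G -> set A) : Prop := IsGrading {
  grading0 : forall g, AG g 0;
  grading_lin : forall g (k : F) (a b : A),
    AG g a -> AG g b -> AG g (k *: a + b);
  grading_direct : forall a : A,
    exists! c : {ffun G -> A}, (forall g, AG g (c g)) /\ a = \sum_g c g;
  grading_mul : forall g h (a b : A),
    AG g a -> AG h b -> AG (g * h)%g (mul a b)
}.

(* sigma acts by (t_1, ..., t_n) |-> (t_sigma(1), ..., t_sigma(n)). *)
Definition permute (T : Type) (n : nat) (t : n.-tuple T) (sigma : 'S_n) :
  n.-tuple T := [tuple tnth t (sigma i) | i < n].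

Definition SymOf (n : nat) (g : n.-tuple G) : {set 'S_n} :=
  [set sigma : 'S_n |
    (\prod_(x <- g) x == \prod_(x <- permute g sigma) x)%g]%SET.

Definition commutation_function := forall n : nat, n.-tuple G -> 'S_n -> F.

Definition homogeneous (AG : G -> set A) (n : nat)
    (g : n.-tuple G) (a : n.-tuple A) : Prop :=
  forall i, AG (tnth g i) (tnth a i).

(* Only the values theta n g sigma with 0 < n and sigma in Sym(g) matter. *)
Record is_regular (AG : G -> set A) (theta : commutation_function) : Prop :=
  IsRegular {
    regular_commutation : forall (n : nat) (g : n.-tuple G) (sigma : 'S_n),
      (0 < n)%N -> sigma \in SymOf g ->
      theta n g sigma != 0 /\
      forall a : n.-tuple A, homogeneous AG g a ->
        mulseq a = theta n g sigma *: mulseq (permute a sigma);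
    regular_nonvanishing : forall (n : nat) (g : n.-tuple G),
      (0 < n)%N ->
      exists a : n.-tuple A, homogeneous AG g a /\ mulseq a != 0
  }.

Definition theta2 (theta : commutation_function) (g h : G) : F :=
  theta 2%N [tuple g; h] (tperm ord0 ord_max).

Definition is_nondegenerate (theta : commutation_function) : Prop :=
  forall g : G, g != 1%g ->
    exists2 g' : G, g' \in 'C[g]%g & theta2 theta g g' != 1.

Definition has_nondegenerate_regular_grading : Prop :=
  exists (AG : G -> set A) (theta : commutation_function),
    [/\ is_grading AG, is_regular AG theta & is_nondegenerate theta].

End Grading.

(* Substitution x_i := rho i; meaningful when the constant term of f is 0. *)
Definition evalp (rho : nat -> A) (f : free_algebra F) : A :=
  \sum_(m <- msupp f) mcoeff m f *: mulseq [seq rho i | i <- fmonom_val m].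

(* As A need not have a unit, Id(A) is taken in the free algebra without unit,
   i.e. among the polynomials with zero constant term.  If A has a unit this
   loses nothing: evaluation at 0 kills the constant term of an identity. *)
Definition Id : set (free_algebra F) :=
  [set f | mcoeff (@one (fmonom nat)) f = 0 /\
           forall rho : nat -> A, evalp rho f = 0].

Definition is_PI : Prop := exists2 f : free_algebra F, f != 0 & Id f.

(* P_n, with the variables numbered from 0 to n - 1. *)
Definition Pmul (n : nat) : set (free_algebra F) :=
  [set f | forall m : fmonom nat,
             m \in msupp f -> perm_eq (fmonom_val m) (iota 0 n)].

End Algebra.

(* dim (P / (P `&` I)) = d: the classes of some b_0, ..., b_(d-1) in P form a
   basis of the quotient. *)
Definition has_quotient_dim (F : fieldType) (V : lmodType F)
    (P I : set V) (d : nat) : Prop :=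
  exists2 b : 'I_d -> V, (forall i, P (b i)) &
    forall f, P f ->
      exists! c : {ffun 'I_d -> F}, (P `&` I) (f - \sum_i c i *: b i).

(* P / (P `&` I) has a dimension as soon as it is finitely spanned. *)
Lemma has_quotient_dim_ex (F : fieldType) (V : lmodType F) (P I : set V) :
    (forall (k : F) u v, P u -> P v -> P (k *: u + v)) -> P 0 ->
    (forall (k : F) u v, I u -> I v -> I (k *: u + v)) -> I 0 ->
    (exists n (s : 'I_n -> V), (forall i, P (s i)) /\
       forall f, P f -> exists c : {ffun 'I_n -> F}, I (f - \sum_i c i *: s i)) ->
  exists d, has_quotient_dim P I d.
Proof.
move=> Plin P0 Ilin I0 exn.
pose Q n := `[< exists s : 'I_n -> V, (forall i, P (s i)) /\
  forall f, P f -> exists c : {ffun 'I_n -> F}, I (f - \sum_i c i *: s i) >].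
have exQ : exists n, Q n by have [n ?] := exn; exists n; apply/asboolP.
case: (ex_minnP exQ) => d /asboolP[s [Ps spans]] mind.
have Isum n (u : 'I_n -> V) (c : 'I_n -> F) :
    (forall i, I (u i)) -> I (\sum_i c i *: u i).
  by move=> Iu; elim/big_ind: _ => // [x y Ix Iy|i _];
     [have := Ilin 1 x y Ix Iy; rewrite scale1r
     |have := Ilin (c i) (u i) 0 (Iu i) I0; rewrite addr0].
have Psum n (u : 'I_n -> V) (c : 'I_n -> F) :
    (forall i, P (u i)) -> P (\sum_i c i *: u i).
  by move=> Pu; elim/big_ind: _ => // [x y Px Py|i _];
     [have := Plin 1 x y Px Py; rewrite scale1r
     |have := Plin (c i) (u i) 0 (Pu i) P0; rewrite addr0].
have IB u v : I u -> I v -> I (u - v).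
  by move=> Iu Iv; have := Ilin (-1) v u Iv Iu; rewrite scaleN1r addrC.
have PB u v : P u -> P v -> P (u - v).
  by move=> Pu Pv; have := Plin (-1) v u Pv Pu; rewrite scaleN1r addrC.
exists d; exists s => // f Pf; have [c Ic] := spans f Pf.
exists c; split=> [|c' [_ Ic']]; first by split=> //; apply: PB => //; exact: Psum.
apply/ffunP => j; apply: contrapT => /eqP; rewrite eq_sym => neq.
pose e i := c' i - c i.
have Ie : I (\sum_i e i *: s i).
  have := IB _ _ Ic Ic'.
  rewrite opprB addrC addrA subrK -sumrB.
  by under eq_bigr do rewrite -scalerBl.
have ej0 : e j != 0 by rewrite subr_eq0.
clearbody e; clear neq Ic Ic' c c'.
case: d s Ps spans mind j e Ie ej0 => [|d] s Ps spans mind j e Ie ej0; first by case: (j).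
suff /mind : Q d by rewrite ltnn.
apply/asboolP; exists (fun k => s (lift j k)); split=> [//|h Ph].
have [b Ib] := spans h Ph.
exists [ffun k => b (lift j k) - b j / e j * e (lift j k)].
suff <- : b j / e j *: (\sum_i e i *: s i) + (h - \sum_i b i *: s i) =
    h - \sum_i [ffun k => b (lift j k) - b j / e j * e (lift j k)] i *: s (lift j i).
  exact: Ilin.
rewrite addrCA; congr (_ + _).
rewrite scaler_sumr -sumrB (bigD1_ord j) //= scalerA divfK // subrr add0r -sumrN.
by apply: eq_bigr => k _; rewrite ffunE scalerA -scalerBl -scaleNr opprB.
Qed.

Lemma evalp_linear (F : fieldType) (A : lmodType F)
    (mul : {bilinear A -> A -> A}) rho (k : F) (f g : free_algebra F) :
  evalp mul rho (k *: f + g) = k *: evalp mul rho f + evalp mul rho g.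
Proof.
pose X : {fset fmonom nat} := (msupp f `|` (msupp g `|` msupp (k *: f + g)))%fset.
have evalE (h : free_algebra F) : (msupp h `<=` X)%fset ->
    evalp mul rho h =
    \sum_(m <- X) mcoeff m h *: mulseq mul [seq rho i | i <- fmonom_val m].
  move=> hX; rewrite /evalp (big_fset_incl _ hX) //= => m _ /mcoeff_outdom ->.
  by rewrite scale0r.
rewrite !evalE; try by apply/fsubsetP => m; rewrite /X !in_fsetU => ->; rewrite ?orbT.
rewrite scaler_sumr -big_split /=; apply: eq_bigr => m _.
by rewrite mcoeffD mcoeffZ scalerA scalerDl.
Qed.

Section Exponent.
Context (F : fieldType) (A : lmodType F) (mul : {bilinear A -> A -> A}).

(* The default 0 is never used, by codimP. *)
Definition codim (n : nat) : nat :=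
  xget 0%N [set d | has_quotient_dim (@Pmul F n) (Id mul) d].

Lemma codimP (n : nat) : has_quotient_dim (@Pmul F n) (Id mul) (codim n).
Proof.
apply: (@xgetPex _ 0%N [set d | has_quotient_dim (@Pmul F n) (Id mul) d]).
have PmulP (f : free_algebra F) : Pmul n f <->
    forall m : fmonom nat, ~~ perm_eq (fmonom_val m) (iota 0 n) -> mcoeff m f = 0.
  split=> [Pf m nm|Pf m].
    by apply: mcoeff_outdom; apply: contra nm; exact: Pf.
  by rewrite -mcoeff_neq0; apply: contraNT => /Pf ->.
apply: has_quotient_dim_ex.
- move=> k u v /PmulP Pu /PmulP Pv; apply/PmulP => m nm.
  by rewrite mcoeffD mcoeffZ Pu // Pv // mulr0 addr0.
- by apply/PmulP => m _; rewrite mcoeff0.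
- move=> k u v [u0 Iu] [v0 Iv]; split; first by rewrite mcoeffD mcoeffZ u0 v0 mulr0 addr0.
  by move=> rho; rewrite evalp_linear Iu Iv scaler0 addr0.
- split=> [|rho]; first by rewrite mcoeff0.
  by have := evalp_linear mul rho (-1) 0 0; rewrite scaler0 addr0 scaleN1r addNr.
pose W := permutations (iota 0 n).
pose w (i : 'I_(size W)) : fmonom nat := FMonom (nth [::] W i).
exists (size W), (fun i => mkmalgU (w i) 1); split=> [i|f /PmulP Pf].
  apply/PmulP => m nm; rewrite mcoeffU; case: eqP => // wm; case/negP: nm.
  by rewrite -wm -mem_permutations mem_nth.
exists [ffun i => mcoeff (w i) f].
rewrite (_ : _ - _ = 0); first split=> [|rho].
- by rewrite mcoeff0.
- by have := evalp_linear mul rho (-1) 0 0; rewrite scaler0 addr0 scaleN1r addNr.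
apply/malgP => m; rewrite mcoeff0 mcoeffB (raddf_sum (mcoeff m)) /=.
case: (boolP (perm_eq (fmonom_val m) (iota 0 n))) => pm; last first.
  rewrite Pf // big1 ?subr0 // => i _; rewrite mcoeffZ mcoeffU.
  case: eqP => [wm|]; last by rewrite mulr0.
  by case/negP: pm; rewrite -wm -mem_permutations mem_nth.
have mW : fmonom_val m \in W by rewrite mem_permutations.
have lt : (index (fmonom_val m) W < size W)%N by rewrite index_mem.
have wE : w (Ordinal lt) = m by case: m mW lt {pm} => m mW lt; rewrite /w /= nth_index.
rewrite (bigD1 (Ordinal lt)) //= big1 => [|i ne].
  by rewrite addr0 mcoeffZ mcoeffU wE eqxx mulr1 ffunE wE subrr.
rewrite mcoeffZ mcoeffU; case: eqP => [wm|]; last by rewrite mulr0.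
case/eqP: ne; apply: val_inj => /=.
by rewrite -wm /= index_uniq // permutations_uniq.
Qed.

Definition codim_root (R : realType) (n : nat) : R :=
  (codim n)%:R `^ (n%:R^-1).

Definition pi_exp (R : realType) : R := limn (codim_root R).

End Exponent.

(* Main.v *)
Require Import Defs.
From HB Require Import structures.
From mathcomp Require Import all_boot all_order all_algebra all_fingroup.
From mathcomp Require Import all_classical all_reals all_analysis.
From mathcomp Require Import finmap.
From mathcomp.multinomials Require Import -(notations) monalg.
From mathcomp Require Import zify ring lra.

(** The exponent is squeezed between elementary bounds on the codimensions c_n.
For one nondegenerate regular grading by G and n > 0,

      |G|^(2n) <= c_n^2 (n+2)^(|G|^2+1)     and     c_n <= |G|^(n+1),

so c_n^(1/n) tends to |G|.  The limit does not mention the grading, hence two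
gradings have groups of the same order.

Upper bound.  On homogeneous elements of degrees h = (h_1, ..., h_n) the value
of a multilinear polynomial splits into components by degree; within one
component all monomials are scalar multiples of a single nonzero monomial.  So
being an identity amounts to at most |G|^(n+1) linear conditions on the n!
coefficients ([codim_le]); once n! is larger they have a nonzero common
solution ([exists_identity]), and A is PI.

Lower bound.  For two orders s, s' of the variables let L(s,s') be the sum, over
the h for which both orders give the same degree, of the scalar that turns the
product in the order s' into the product in the order s.  Identities pair to
zero with every column of this n! by n! matrix, so it has rank at most c_n
([corr_factor]).  For an integer matrix Z one has (tr Z)^2 <= rank Z * sum Z^2
([sqr_mxtrace_le]), but L need not have integer entries.  Its quadratic version
   Z(s,s') = |G| L(rev s, rev s') L(s,s')
does, and has rank at most c_n^2.  Indeed Z is the sum of the scalars attached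
to the nested words k_n ... k_1 v h_1 ... h_n, the k and the h both being taken
in the order s or both in the order s': by nondegeneracy the sum over the
central letter v kills every term except those that split as a product
([sum_nested_coef_center]).  The same sum can be sorted by the walk in G formed
by the values of the inner words.  If the walk read along s is not also a walk
along s', nondegeneracy, applied at the first letter where the two disagree,
cancels everything ([edge_sum_step]); if it is, each scalar is 1 or -1, because
after regrouping into central factors only letters of equal degree are permuted
([nested_coef_sqr]).  So Z(s,s') is an integer, at most |G|^n times the number
of common walks.  Two orders share a walk P exactly when P is invariant under
the quotient of their two successor permutations, and pairs of a function and a
permutation fixing it are few ([sum_card_invariant]); this bounds sum Z^2, the
square of a number of walks being a number of walks in G * G.  Since
tr Z = n! |G|^(2n+1), the lower bound follows ([codim_ge]). *)

Set Implicit Arguments.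
Unset Strict Implicit.
Unset Printing Implicit Defensive.

Import Order.TTheory GRing.Theory Num.Theory.
Import numFieldNormedType.Exports.

Local Open Scope ring_scope.

(** * Ranks and traces of integer matrices *)

(** A vector v killed by the Gram matrix satisfies |v B|^2 = 0. *)
Lemma gram_unitmx (Q : realFieldType) (r N : nat) (B : 'M[Q]_(r, N)) :
  row_free B -> B *m B^T \in unitmx.
Proof.
move=> freeB; rewrite -row_free_unit -kermx_eq0; apply/eqP/row_matrixP => i.
suff ker0 (v : 'rV_r) : v *m (B *m B^T) = 0 -> v = 0.
  by rewrite row0; apply: ker0; rewrite -row_mul mulmx_ker row0.
move=> vG; apply: (row_free_inj freeB); rewrite mul0mx.
have /matrixP/(_ 0 0) : (v *m B) *m (v *m B)^T = 0.
  by rewrite trmx_mul mulmxA -(mulmxA v) vG mul0mx.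
move: (v *m B) => w; rewrite !mxE => /eqP; rewrite psumr_eq0 => [/allP w0|j _].
  apply/rowP => j; rewrite mxE; apply/eqP.
  by have := w0 j (mem_index_enum _); rewrite /= mxE -expr2 sqrf_eq0.
by rewrite mxE -expr2 sqr_ge0.
Qed.

(** Let P be the orthogonal projection onto the row space of Z.  Then tr Z is the
scalar product of Z and P, while |P|^2 = tr P is the rank of Z, so this is the
Cauchy-Schwarz inequality. *)
Lemma sqr_mxtrace_le (Q : realFieldType) (N : nat) (Z : 'M[Q]_N) :
  (\tr Z) ^+ 2 <= (\rank Z)%:R * \sum_i \sum_j Z i j ^+ 2.
Proof.
have [r0|rpos] := posnP (\rank Z).
  have /eqP -> : Z == 0 by rewrite -mxrank_eq0 r0.
  by rewrite mxtrace0 expr0n mulr_ge0 // sumr_ge0 // => i _; rewrite sumr_ge0 // => j _;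
    rewrite sqr_ge0.
have [B freeB /submxP[D ZE]] : exists2 B : 'M[Q]_(\rank Z, N), row_free B & (Z <= B)%MS.
  by exists (row_base Z); [exact: row_base_free|rewrite eq_row_base].
pose P := B^T *m invmx (B *m B^T) *m B.
have uG : B *m B^T \in unitmx by apply/gram_unitmx.
have BP : B *m P = B by rewrite /P !mulmxA mulmxV // mul1mx.
have ZP : Z *m P = Z by rewrite ZE -mulmxA BP.
have trP : \tr P = (\rank Z)%:R.
  by rewrite /P mxtrace_mulC mulmxA mulmxV // mxtrace1.
have PT : P^T = P.
  have GT : (B *m B^T)^T = B *m B^T by rewrite trmx_mul trmxK.
  by rewrite /P trmx_mul trmx_mul trmx_inv GT trmxK mulmxA.

have PP : P *m P = P by rewrite {1}/P -mulmxA BP.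
clearbody P.
have PTE i j : P j i = P i j by rewrite -{1}PT mxE.
have sumP : \sum_i \sum_j P i j ^+ 2 = (\rank Z)%:R.
  rewrite -trP -{2}PP; apply: eq_bigr => i _; rewrite mxE; apply: eq_bigr => j _.
  by rewrite PTE expr2.
have sumZP : \sum_i \sum_j Z i j * P i j = \tr Z.
  rewrite -{2}ZP; apply: eq_bigr => i _; rewrite mxE; apply: eq_bigr => j _.
  by rewrite PTE.
(* c P is the projection of Z onto the line of P; expand |Z - c P|^2 >= 0. *)
pose c := \tr Z / (\rank Z)%:R.
have : 0 <= \sum_i \sum_j (Z i j - c * P i j) ^+ 2.
  by apply: sumr_ge0 => i _; apply: sumr_ge0 => j _; rewrite sqr_ge0.
have sqrE i j : (Z i j - c * P i j) ^+ 2 =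
    Z i j ^+ 2 + (- (2 * c) * (Z i j * P i j) + c ^+ 2 * P i j ^+ 2) by ring.
under eq_bigr => i _.
  under eq_bigr do rewrite sqrE.
  rewrite !big_split -!mulr_sumr /=.
  over.
rewrite !big_split -!mulr_sumr /= sumZP sumP.
have r0 : 0 < (\rank Z)%:R :> Q by rewrite ltr0n.
have -> : - (2 * c) * \tr Z + c ^+ 2 * (\rank Z)%:R = - (\tr Z ^+ 2 / (\rank Z)%:R).
  by rewrite /c; field; rewrite gt_eqF.
by rewrite subr_ge0 ler_pdivrMr // mulrC.
Qed.

Lemma intr_neq0_pchar (F : fieldType) (m : int) :
  [pchar F] =i pred0 -> m != 0 -> m%:~R != 0 :> F.
Proof.
move=> /pcharf0P charF; case: m => m m0; first by rewrite -pmulrn charF.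
by rewrite NegzE mulrNz oppr_eq0 -pmulrn charF.
Qed.

Lemma ratr_div (F : fieldType) (a b : int) : [pchar F] =i pred0 -> b != 0 ->
  ratr (a%:~R / b%:~R) = a%:~R / b%:~R :> F.
Proof.
move=> charF b0.
have inj m := @intr_neq0_pchar F m charF.
rewrite /ratr; set x := _ / _ : rat.
have d0 : (denq x) != 0 := denq_neq0 x.
apply/eqP; rewrite eqr_div ?inj // -!intrM; apply/eqP; congr (_%:~R).
apply/eqP; rewrite -(@eqr_int rat) !intrM; apply/eqP.
have : x * (denq x)%:~R = (numq x)%:~R by rewrite numqE.
move=> <-; rewrite /x mulrAC; field.
by rewrite intr_eq0.
Qed.

(** Transports ranks of rational matrices to F; the canonical morphism instances
of ratr ask for an ordered target. *)
Lemma ratr_rmorphism (F : fieldType) : [pchar F] =i pred0 ->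
  exists f : {rmorphism rat -> F}, True.
Proof.
move=> charF.
have ratE (x : rat) : exists a b : int, b != 0 /\ x = a%:~R / b%:~R.
  by exists (numq x), (denq x); rewrite denq_neq0 divq_num_den.
have Fnz m := @intr_neq0_pchar F m charF.
have Qnz m := @intr_neq0_pchar rat m (pchar_num _).
have fB : zmod_morphism (@ratr F).
  move=> x y; have [a [b [b0 ->]]] := ratE x; have [c [d [d0 ->]]] := ratE y.
  rewrite (_ : _ - _ = (a * d - c * b)%:~R / (b * d)%:~R :> rat).
    by rewrite !ratr_div ?mulf_neq0 // !rmorphB !rmorphM /=; field; rewrite !Fnz.
  by rewrite !rmorphB !rmorphM /=; field; rewrite !Qnz.
have fM : monoid_morphism (@ratr F).
  split=> [|x y].
    by have := @ratr_div F 1 1 charF isT; rewrite !divr1.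
  have [a [b [b0 ->]]] := ratE x; have [c [d [d0 ->]]] := ratE y.
  rewrite (_ : _ * _ = (a * c)%:~R / (b * d)%:~R :> rat).
    by rewrite !ratr_div ?mulf_neq0 // !rmorphM /=; field; rewrite !Fnz.
  by rewrite !rmorphM /=; field; rewrite !Qnz.
pose hB := GRing.isZmodMorphism.Build rat F (@ratr F) fB.
pose hM := GRing.isMonoidMorphism.Build rat F (@ratr F) fM.
by exists (HB.pack_for {rmorphism rat -> F} (@ratr F) hB hM).
Qed.

Lemma sum_enum_val (R : nmodType) (S : finType) (h : S -> R) :
  \sum_s h s = \sum_(i < #|S|) h (enum_val i).
Proof. by rewrite -big_enum_val; apply: eq_bigl. Qed.

(** The form of the trace inequality used below: the factorization of z through K
is known over F only, the sizes of the entries are those of integers. *)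
Lemma sqr_trace_le_factor (F : fieldType) (T K : finType)
    (x : T -> K -> F) (y : K -> T -> F) (z : T -> T -> int) :
  [pchar F] =i pred0 ->
  (forall s t, (z s t)%:~R = \sum_k x s k * y k t) ->
  (\sum_s z s s) ^+ 2 <= #|K|%:R * \sum_s \sum_t z s t ^+ 2.
Proof.
move=> charF zE; have [f _] := ratr_rmorphism charF.
pose Z : 'M[rat]_#|T| := \matrix_(i, j) (z (enum_val i) (enum_val j))%:~R.
have rkZ : (\rank Z <= #|K|)%N.
  rewrite -(mxrank_map f).
  pose X : 'M[F]_(#|T|, #|K|) := \matrix_(i, k) x (enum_val i) (enum_val k).
  pose Y : 'M[F]_(#|K|, #|T|) := \matrix_(k, j) y (enum_val k) (enum_val j).
  suff -> : map_mx f Z = X *m Y by apply: leq_trans (rank_leq_col X); exact: mxrankM_maxl.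
  apply/matrixP => i j; rewrite !mxE rmorph_int zE sum_enum_val /=.
  by apply: eq_bigr => k _; rewrite !mxE.
rewrite -(ler_int rat) rmorphXn rmorphM !rmorph_sum /= natz.
have := sqr_mxtrace_le Z.
have -> : \tr Z = \sum_s (z s s)%:~R.
  by rewrite [RHS]sum_enum_val /=; apply: eq_bigr => i _; rewrite mxE.
have -> : \sum_i \sum_j Z i j ^+ 2 = \sum_s (\sum_t z s t ^+ 2)%:~R.
  rewrite [RHS]sum_enum_val /=; apply: eq_bigr => i _.
  rewrite rmorph_sum [RHS]sum_enum_val /=; apply: eq_bigr => j _.
  by rewrite mxE rmorphXn.
move=> /le_trans; apply; rewrite ler_wpM2r //.
  by apply: sumr_ge0 => s _; rewrite ler0z sumr_ge0 // => t _; rewrite sqr_ge0.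
by rewrite -pmulrn ler_nat.
Qed.

(** A matrix with more rows than columns has a nonzero left kernel. *)
Lemma dependent_rows (F : fieldType) (S K : finType) (x : S -> K -> F) :
  (#|K| < #|S|)%N ->
  exists2 c : {ffun S -> F}, (exists s, c s != 0) & forall k, \sum_s c s * x s k = 0.
Proof.
move=> ltKS; pose M : 'M[F]_(#|S|, #|K|) := \matrix_(i, j) x (enum_val i) (enum_val j).
have : kermx M != 0.
  rewrite kermx_eq0 /row_free neq_ltn; apply/orP; left.
  by apply: leq_ltn_trans ltKS; apply: rank_leq_col.
move=> /eqP/eqP/matrix0Pn[i [j ij0]]; pose v := row i (kermx M).
have vM : v *m M = 0 by rewrite -row_mul mulmx_ker row0.
exists [ffun s => v 0 (enum_rank s)].
  by exists (enum_val j); rewrite ffunE enum_valK mxE.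
move=> k; have /matrixP/(_ 0 (enum_rank k)) := vM; rewrite !mxE => vk.
rewrite -[RHS]vk [LHS]sum_enum_val.
by apply: eq_bigr => a _; rewrite ffunE enum_valK [M _ _]mxE enum_rankK.
Qed.

(** * Counting functions invariant under a permutation *)

Section Counting.
Local Open Scope nat_scope.

(** On each fiber of P, g matches the enumerations of the two fibers of equal size. *)
Lemma perm_of_fibers (X Y : finType) (P Q : {ffun Y -> X}) :
  (forall x, #|[pred y | P y == x]| = #|[pred y | Q y == x]|) ->
  exists g : {perm Y}, forall y, P y = Q (g y).
Proof.
move=> PQ; pose fib (R : {ffun Y -> X}) x := enum [pred y | R y == x].
pose g y := nth y (fib Q (P y)) (index y (fib P (P y))).
have ltg y : index y (fib P (P y)) < size (fib Q (P y)).
  by rewrite -cardE -PQ cardE index_mem mem_enum inE /= eqxx.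
have Qg y : Q (g y) = P y.
  by apply/eqP; have := mem_nth y (ltg y); rewrite mem_enum inE.
have gI : injective g.
  move=> y y' gE; have PE : P y = P y' by rewrite -!Qg gE.
  move: gE; rewrite /g PE.
  have lt1 := ltg y; have lt2 := ltg y'; rewrite PE in lt1.
  rewrite (set_nth_default y y' lt2) => /eqP.
  rewrite nth_uniq ?enum_uniq // => /eqP iE.
  have yin : y \in fib P (P y') by rewrite mem_enum inE /= PE.
  have yin' : y' \in fib P (P y') by rewrite mem_enum inE /=.
  by rewrite -(nth_index y yin) iE nth_index.
by exists (perm gI) => y; rewrite permE Qg.
Qed.

(** By Burnside, the left-hand side is (#|Y|)! times the number of orbits of the
permutations of Y on functions, and an orbit is determined by the sizes of the
fibers.  The proof replaces orbit counting by an injection: composing rho with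
a permutation that brings P to a normal form gives a permutation from which,
with the fiber sizes, both P and rho can be recovered. *)
Lemma sum_card_invariant (X Y : finType) :
  \sum_(rho : {perm Y}) #|[set P : {ffun Y -> X} | [forall y, P (rho y) == P y]]|
    <= (#|Y|)`! * #|Y|.+1 ^ #|X|.
Proof.
pose S := [set w : {ffun Y -> X} * {perm Y} | [forall y, w.1 (w.2 y) == w.1 y]].
have -> : \sum_(rho : {perm Y})
    #|[set P : {ffun Y -> X} | [forall y, P (rho y) == P y]]| = #|S|.
  under eq_bigr do rewrite cardsE -sum1_card.
  rewrite (exchange_big_dep xpredT) //= pair_big_dep /= -sum1_card.
  by apply: eq_bigl => w; rewrite !inE.
pose prof (P : {ffun Y -> X}) : {ffun X -> 'I_#|Y|.+1} :=
  [ffun x => inord #|[pred y | P y == x]|].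
pose r (f : {ffun X -> 'I_#|Y|.+1}) : option {ffun Y -> X} := [pick Q | prof Q == f].
pose good (P : {ffun Y -> X}) : pred {perm Y} := fun g =>
  if r (prof P) is Some Q then [forall y, P y == Q (g y)] else false.
have gex (P : {ffun Y -> X}) : exists g, good P g.
  rewrite /good /r; case: pickP => [Q /eqP QP|/(_ P)]; last by rewrite eqxx.
  have [|g gE] := @perm_of_fibers _ _ P Q; last by exists g; apply/forallP => y; rewrite gE.
  move=> x; have /ffunP/(_ x)/(congr1 val) := QP; rewrite !ffunE /= !inordK ?ltnS ?max_card //.
pose g P := xchoose (gex P).
pose h (w : {ffun Y -> X} * {perm Y}) := (prof w.1, (w.2 * g w.1)%g).
have hI : {in S &, injective h}.
  move=> [P rho] [P' rho']; rewrite !inE /= => /forallP Pr /forallP Pr' [pE gE].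
  have := xchooseP (gex P); have := xchooseP (gex P').
  rewrite -/(g P) -/(g P') /good -pE; case: (r _) => // Q /forallP Q' /forallP QP.
  have PP' : P = P'.
    apply/ffunP => y; rewrite -(eqP (Pr y)) -(eqP (Pr' y)).
    rewrite (eqP (QP _)) (eqP (Q' _)).
    by have /permP/(_ y) := gE; rewrite !permM => ->.
  by subst P'; congr (_, _); apply: (mulIg (g P)).
rewrite -(card_in_imset hI).
apply: leq_trans (max_card _) _; rewrite card_prod.
have -> : #|{perm Y}| = #|perm_on [set: Y]|.
  by apply: eq_card => rho; apply/esym/fintype.subsetP => y _; rewrite inE.
by rewrite card_ffun card_ord card_perm cardsT mulnC.
Qed.

Section Successor.
Context (I : finType).
Implicit Types (s : seq I) (sigma : {perm I}).

Definition order_of sigma : seq I := [seq sigma i | i <- enum I].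

(** The successor in the cyclic order None, s_1, ..., s_n, the letter None marking
both ends of s.  With it, consecutive steps of a walk become one equation
(see [chain_walk]). *)
Definition succ_in s (o : option I) : option I := next (None :: map Some s) o.

Lemma order_uniq sigma : uniq (order_of sigma).
Proof. by rewrite map_inj_uniq ?enum_uniq //; exact: perm_inj. Qed.

Lemma mem_order sigma i : i \in order_of sigma.
Proof. by rewrite -[i](permKV sigma) map_f ?mem_enum. Qed.

Lemma order_inj : injective order_of.
Proof. by move=> s t /eq_in_map st; apply/permP => i; apply: st; rewrite mem_enum. Qed.

Lemma cycle_uniq s : uniq s -> uniq (None :: map Some s).
Proof. by move=> us; rewrite /= map_inj_uniq ?us ?andbT; [apply/mapP => -[]|move=> ? ? []]. Qed.

Lemma map_succ_in s : uniq s ->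
  [seq succ_in s o | o <- None :: map Some s] = rcons (map Some s) None.
Proof.
move=> us; apply: (@eq_from_nth _ None); first by rewrite size_map size_rcons.
move=> j; rewrite size_map => lt_j; rewrite (nth_map None) // /succ_in next_nth.
rewrite mem_nth // index_uniq ?cycle_uniq // nth_rcons /=.
have := lt_j; rewrite /= ltnS leq_eqVlt => /orP[/eqP ->|lt].
  by rewrite ltnn eqxx nth_default.
by rewrite lt.
Qed.

Lemma succ_in_inj s : uniq s -> injective (succ_in s).
Proof. by move=> us; apply: can_inj (prev_next (cycle_uniq us)). Qed.

Lemma succ_in_order s : uniq s ->
  map Some s = traject (succ_in s) (succ_in s None) (size s).
Proof.
move=> us; rewrite -(size_map Some); apply: fpathE.
by have := cycle_next (cycle_uniq us); rewrite /= rcons_path => /andP[].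
Qed.

(** Composing with the inverse of the successor permutation of s turns the functions
counted here into functions invariant under a permutation, and an order can be
read off from its successor permutation. *)
Lemma sum_card_successor (X : finType) (s : seq I) : uniq s ->
  \sum_(sigma : {perm I}) #|[set P : {ffun option I -> X} |
      [forall o, P (succ_in (order_of sigma) o) == P (succ_in s o)]]|
    <= #|I|.+1`! * #|I|.+2 ^ #|X|.
Proof.
move=> us; pose c sigma : {perm option I} := perm (succ_in_inj (order_uniq sigma)).
pose c0 : {perm option I} := perm (succ_in_inj us).
have cI : injective (fun sigma => (c0^-1 * c sigma)%g).
  move=> sigma tau /mulgI ct; apply: order_inj; apply: (@inj_map _ _ (@Some I)) => [? ? []//|].
  have E o : succ_in (order_of sigma) o = succ_in (order_of tau) o.
    by have /permP/(_ o) := ct; rewrite !permE.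
  by rewrite !succ_in_order ?order_uniq // E !size_map; elim: size (succ_in _ _) => //= m
    IHm x; rewrite E IHm.
have -> : \sum_(sigma : {perm I}) #|[set P : {ffun option I -> X} |
      [forall o, P (succ_in (order_of sigma) o) == P (succ_in s o)]]| =
   \sum_(rho in [set (c0^-1 * c sigma)%g | sigma : {perm I}])
     #|[set P : {ffun option I -> X} | [forall o, P (rho o) == P o]]|.
  rewrite big_imset /=; last by move=> ? ? _ _; exact: cI.
  apply: eq_bigr => sigma _; apply: eq_card => P; rewrite !inE.
  apply/forallP/forallP => H o.
    have := H (c0^-1 o)%g; rewrite permM [c sigma _]permE.
    by rewrite -[succ_in s _](permE (succ_in_inj us)) -/c0 permKV.
  by have := H (c0 o); rewrite permM permK [c sigma _]permE [c0 _]permE.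
rewrite -card_option; apply: leq_trans (sum_card_invariant X (option I)).
by rewrite [leqRHS](bigID (mem [set (c0^-1 * c sigma)%g | sigma : {perm I}])) leq_addr.
Qed.
End Successor.

End Counting.

Local Open Scope classical_set_scope.

(** * Multilinear polynomials *)

Section Multilinear.
Context (F : fieldType) (A : lmodType F) (mul : {bilinear A -> A -> A}) (n : nat).
Implicit Types (f : free_algebra F) (s : seq 'I_n) (sigma tau : {perm 'I_n}).

Definition mword s : fmonom nat := FMonom (map val s).
Notation mperm sigma := (mword (order_of sigma)).

Lemma size_order sigma : size (order_of sigma) = n.
Proof. by rewrite size_map size_enum_ord. Qed.

Lemma perm_order sigma : perm_eq (order_of sigma) (enum 'I_n).
Proof.
apply: uniq_perm; [exact: order_uniq|exact: enum_uniq|].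
by move=> i; rewrite mem_order mem_enum.
Qed.

Lemma perm_enumP s : perm_eq s (enum 'I_n) -> exists sigma, s = order_of sigma.
Proof.
move=> ss; have /tuple_permP[p sE] : perm_eq s (ord_tuple n) by [].
by exists p; rewrite sE /=; apply: eq_map => i; rewrite tnth_ord_tuple.
Qed.

Lemma mword_inj : injective mword.
Proof. by move=> s s' [] /inj_map; apply; exact: val_inj. Qed.

Lemma mperm_inj : injective (fun sigma => mperm sigma).
Proof. by move=> sigma tau /mword_inj/order_inj. Qed.

Lemma mpermP (m : fmonom nat) :
  reflect (exists sigma, m = mperm sigma) (perm_eq (fmonom_val m) (iota 0 n)).
Proof.
apply: (iffP idP) => [|[sigma ->]]; last first.
  by rewrite /= -val_enum_ord perm_map // perm_order.
case: m => m /=; rewrite -val_enum_ord => mm.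
have /tuple_permP[p mE] : perm_eq m (map_tuple val (ord_tuple n)) by [].
exists p; congr FMonom; rewrite mE /order_of /= -map_comp; apply: eq_map => i /=.
by rewrite tnth_map tnth_ord_tuple.
Qed.

(** Membership in P_n by coefficients, which makes linearity immediate. *)
Lemma PmulP f : Pmul n f <->
  forall m, (forall sigma, m <> mperm sigma) -> mcoeff m f = 0.
Proof.
split=> [Pf m mE|Pf m mf].
  apply: mcoeff_outdom; apply/negP => /Pf/mpermP[sigma ms]; exact: (mE sigma).
apply/mpermP; apply: contrapT => nex; move: mf; rewrite -mcoeff_neq0 Pf ?eqxx //.
by move=> sigma mE; apply: nex; exists sigma.
Qed.

Lemma Pmul_lin (k : F) f g : Pmul n f -> Pmul n g -> Pmul n (k *: f + g).
Proof.
move=> /PmulP Pf /PmulP Pg; apply/PmulP => m mE.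
by rewrite mcoeffD mcoeffZ Pf // Pg // mulr0 addr0.
Qed.

Lemma Pmul0 : Pmul n (0 : free_algebra F).
Proof. by apply/PmulP => m _; rewrite mcoeff0. Qed.

Lemma Pmul_sum (T : finType) (c : T -> F) (b : T -> free_algebra F) :
  (forall t, Pmul n (b t)) -> Pmul n (\sum_t c t *: b t).
Proof.
move=> Pb; elim/big_rec: _ => [|t f _ Pf]; first exact: Pmul0.
exact: Pmul_lin.
Qed.

Lemma Pmul_mperm sigma : Pmul n (mkmalgU (mperm sigma) (1 : F)).
Proof.
by apply/PmulP => m mE; rewrite mcoeffU; case: eqP => // /esym /mE.
Qed.

Lemma Pmul_expand f : Pmul n f ->
  f = \sum_sigma mcoeff (mperm sigma) f *: mkmalgU (mperm sigma) 1.
Proof.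
move=> /PmulP Pf; apply/malgP => m; rewrite (raddf_sum (mcoeff m)) /=.
have [[sigma ->]|nex] := pselect (exists sigma, m = mperm sigma).
  rewrite (bigD1 sigma) //.
  rewrite [X in _ = X + _]mcoeffZ mcoeffUU.
  rewrite mulr1 big1 => [|tau ts]; first by rewrite addr0.
  rewrite [LHS]mcoeffZ mcoeffU; case: eqP => [/mperm_inj/eqP|]; last by rewrite mulr0.
  by rewrite (negPf ts).
rewrite Pf => [|sigma mE]; last by apply: nex; exists sigma.
rewrite big1 // => sigma _; rewrite [LHS]mcoeffZ mcoeffU; case: eqP; last by rewrite mulr0.
by move=> mE; case: nex; exists sigma.
Qed.

Lemma evalp0 rho : evalp mul rho 0 = 0.
Proof. by have := evalp_linear mul rho (-1) 0 0; rewrite scaler0 addr0 scaleN1r addNr. Qed.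

Lemma evalp_sum rho (T : finType) (c : T -> F) (b : T -> free_algebra F) :
  evalp mul rho (\sum_t c t *: b t) = \sum_t c t *: evalp mul rho (b t).
Proof.
elim/big_ind2: _ => [|x f y g <- <-|t _]; first exact: evalp0.
  by have := evalp_linear mul rho 1 f g; rewrite !scale1r.
by have := evalp_linear mul rho (c t) (b t) 0; rewrite !addr0 evalp0 addr0.
Qed.

Lemma evalp_mperm rho sigma :
  evalp mul rho (mkmalgU (mperm sigma) 1) = mulseq mul (map (rho \o val) (order_of sigma)).
Proof.
by rewrite /evalp msuppU1 big_seq_fset1 mcoeffUU scale1r /= -map_comp.
Qed.

Lemma evalp_Pmul rho f : Pmul n f -> evalp mul rho f =
  \sum_sigma mcoeff (mperm sigma) f *: mulseq mul (map (rho \o val) (order_of sigma)).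
Proof.
move=> Pf; rewrite {1}(Pmul_expand Pf) evalp_sum.
by apply: eq_bigr => sigma _; rewrite evalp_mperm.
Qed.

Lemma Id_PmulP f : (0 < n)%N -> Pmul n f ->
  (Id mul f <-> forall a : 'I_n -> A,
     \sum_sigma mcoeff (mperm sigma) f *: mulseq mul (map a (order_of sigma)) = 0).
Proof.
move=> n0 Pf; split=> [[_ If] a|If]; last first.
  split=> [|rho]; last by rewrite evalp_Pmul.
  have /PmulP := Pf; apply=> sigma /(congr1 (size \o @fmonom_val _)).
  by rewrite /= /mone /one /= fmoneE /= size_map size_order => n0E; rewrite -n0E in n0.
pose rho j := if insub j is Some i then a i else 0.
rewrite -[RHS](If rho) evalp_Pmul //; apply: eq_bigr => sigma _; congr (_ *: mulseq _ _).
by apply: eq_map => i; rewrite /= /rho valK.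
Qed.

End Multilinear.

(** * Words and proportionality *)

Section GradedAlgebra.
Context (F : fieldType) (A : lmodType F) (mul : {bilinear A -> A -> A}).
Implicit Types (w : seq A).

Notation act := (foldl mul).

(** Words in A act on A by multiplication on the right.  Comparing actions, rather
than the products themselves, gives the empty word a meaning although A need
not have a unit, and makes proportionality compatible with concatenation. *)
Definition sim c w w' := forall x, foldl mul x w = c *: foldl mul x w'.

Lemma foldl_mulZ k x w : foldl mul (k *: x) w = k *: foldl mul x w.
Proof. by elim: w x => //= a w IHw x; rewrite linearZl_LR IHw. Qed.

Lemma foldl_mulD x y w : foldl mul (x + y) w = foldl mul x w + foldl mul y w.
Proof. by elim: w x y => //= a w IHw x y; rewrite linearDl IHw. Qed.

Lemma sim_refl w : sim 1 w w.
Proof. by move=> x; rewrite scale1r. Qed.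

Lemma sim_trans w2 c d w1 w3 : sim c w1 w2 -> sim d w2 w3 -> sim (c * d) w1 w3.
Proof. by move=> S1 S2 x; rewrite S1 S2 scalerA. Qed.

Lemma sim1_trans w2 c w1 w3 : sim 1 w1 w2 -> sim c w2 w3 -> sim c w1 w3.
Proof. by move=> S1 S2; rewrite -[c]mul1r; apply: sim_trans S2. Qed.

Lemma sim_trans1 w2 c w1 w3 : sim c w1 w2 -> sim 1 w2 w3 -> sim c w1 w3.
Proof. by move=> S1 S2; rewrite -[c]mulr1; apply: sim_trans S2. Qed.

Lemma sim1_sym w w' : sim 1 w w' -> sim 1 w' w.
Proof. by move=> S x; rewrite S !scale1r. Qed.

Lemma sim_ctx p q c w w' : sim c w w' -> sim c (p ++ w ++ q) (p ++ w' ++ q).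
Proof. by move=> S x; rewrite !foldl_cat S foldl_mulZ. Qed.

Lemma sim_cat c d u u' w w' :
  sim c u u' -> sim d w w' -> sim (c * d) (u ++ w) (u' ++ w').
Proof. by move=> S S' x; rewrite !foldl_cat S foldl_mulZ S' scalerA. Qed.

Lemma sim_catl p c w w' : sim c w w' -> sim c (p ++ w) (p ++ w').
Proof. by move=> S; have := sim_ctx p [::] S; rewrite !cats0. Qed.

Lemma sim_catr q c w w' : sim c w w' -> sim c (w ++ q) (w' ++ q).
Proof. exact: (sim_ctx [::] q). Qed.

(** How scalars are identified throughout: two ways of rewriting w into a word that
acts nontrivially must give the same factor. *)
Lemma sim_inj w w' c d : (exists x, foldl mul x w' != 0) ->
  sim c w w' -> sim d w w' -> c = d.
Proof.
move=> [x x0] Sc Sd; apply/eqP; rewrite -subr_eq0.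
have /eqP : (c - d) *: foldl mul x w' = 0 by rewrite scalerBl -Sc -Sd subrr.
by rewrite scaler_eq0 (negPf x0) orbF.
Qed.

Hypothesis mulA : associative mul.

Lemma mul_foldl y x w : mul y (foldl mul x w) = foldl mul (mul y x) w.
Proof. by elim: w x => //= a w IHw x; rewrite IHw mulA. Qed.

Lemma mul_mulseq y w : w != [::] -> mul y (mulseq mul w) = foldl mul y w.
Proof. by case: w => //= x w _; rewrite mul_foldl. Qed.

Context (G : finGroupType) (AG : G -> set A) (theta : commutation_function F G).
Hypotheses (gradA : is_grading mul AG) (regA : is_regular mul AG theta).
Hypothesis ndegA : is_nondegenerate theta.

Fixpoint homw (g : G) (w : seq A) : Prop :=
  if w is a :: w' then exists2 h, AG h a & homw (h^-1 * g)%g w' else g = 1%g.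

Lemma homw_cons h g a w : AG h a -> homw g w -> homw (h * g)%g (a :: w).
Proof. by move=> ha gw; exists h => //; rewrite mulKg. Qed.

Lemma homw1 g a : AG g a -> homw g [:: a].
Proof. by move=> ga; exists g => //=; rewrite mulVg. Qed.

Lemma homw_cat g h u w : homw g u -> homw h w -> homw (g * h)%g (u ++ w).
Proof.
elim: u g => [|a u IHu] g /=; first by move=> ->; rewrite mul1g.
by move=> [k ka gu] hw; exists k => //; rewrite mulgA; apply: IHu.
Qed.

Lemma homw_map (X : Type) (d : X -> G) (a : X -> A) (s : seq X) :
  (forall x, AG (d x) (a x)) -> homw (\prod_(x <- s) d x)%g (map a s).
Proof.
move=> ha; elim: s => [|x s IHs] /=; first by rewrite big_nil.
by rewrite big_cons; apply: homw_cons.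
Qed.

Lemma AG_foldl g h x w : AG g x -> homw h w -> AG (g * h)%g (foldl mul x w).
Proof.
elim: w g h x => [|a w IHw] g h x gx /=; first by move=> ->; rewrite mulg1.
move=> [k ka hw]; have := IHw (g * k)%g _ _ (grading_mul gradA gx ka) hw.
by rewrite -mulgA mulKVg.
Qed.

Lemma homw_mulseq g w : w != [::] -> homw g w -> AG g (mulseq mul w).
Proof.
case: w => //= a w _ [h ha gw].
by have := AG_foldl ha gw; rewrite mulKVg.
Qed.

(** * Regular gradings *)

Definition assigned (X : Type) (d : X -> G) (a : X -> A) := forall x, AG (d x) (a x).

(** Regularity for letters indexed by any type.  The letters must be distinct: the
square of a homogeneous element may well vanish. *)
Lemma nonvanishing (X : eqType) (d : X -> G) (s : seq X) : uniq s -> s != [::] ->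
  exists a, assigned d a /\ mulseq mul (map a s) != 0.
Proof.
move=> us s0; have n0 : (0 < size s)%N by rewrite lt0n size_eq0.
have [t [ht tn0]] := regular_nonvanishing regA (map_tuple d (in_tuple s)) n0.
exists (fun x => if x \in s then nth 0 t (index x s) else 0); split.
  move=> x; case: ifP => [xs|_]; last exact: grading0 gradA _.
  have lt : (index x s < size s)%N by rewrite index_mem.
  have := ht (Ordinal lt); rewrite (tnth_nth 0) tnth_map (tnth_nth x) /=.
  by rewrite nth_index.
congr (mulseq mul _ != 0): tn0; apply: (@eq_from_nth _ 0).
  by rewrite size_map size_tuple.
move=> j; rewrite size_tuple => lt.
case: s us s0 n0 t ht lt => // x0 s us s0 n0 t ht lt.
by rewrite (nth_map x0) // mem_nth // index_uniq.
Qed.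

(** One more letter, of degree 1, on which the word acts. *)
Lemma nonvanishing_act (X : eqType) (d : X -> G) (s : seq X) : uniq s ->
  exists a, assigned d a /\ exists y, act y (map a s) != 0.
Proof.
move=> us; pose d' o := if o is Some x then d x else 1%g.
have us' : uniq (None :: map Some s).
  by rewrite /= map_inj_uniq ?us ?andbT; [apply/mapP => -[]|move=> ? ? []].
have [a [ha a0]] := nonvanishing d' us' isT.
exists (a \o Some); split=> [x|]; first exact: (ha (Some x)).
by exists (a None); rewrite map_comp.
Qed.

Lemma nonvanishing_act2 (X Z : eqType) (d : X -> G) (e : Z -> G) (s : seq X) (t : seq Z) :
  uniq s -> uniq t ->
  exists a b, [/\ assigned d a, assigned e b & exists y, act y (map a s ++ map b t) != 0].
Proof.
move=> us ut; pose de z := match z with inl x => d x | inr z => e z end.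
have ust : uniq (map inl s ++ map inr t : seq (X + Z)).
  rewrite cat_uniq !map_inj_uniq ?us ?ut; try by move=> ? ? [].
  by rewrite andbT; apply/hasPn => _ /mapP[z _ ->]; apply/mapP => -[].
have [a [ha a0]] := nonvanishing_act de ust.
exists (a \o inl), (a \o inr); split; [exact: (fun x => ha (inl x))|exact: (fun x => ha
  (inr x))|].
by have [y] := a0; rewrite map_cat -!map_comp; exists y.
Qed.

Definition reorders (X : eqType) (d : X -> G) (s s' : seq X) : set F :=
  [set c | forall a, assigned d a -> mulseq mul (map a s) = c *: mulseq mul (map a s')].

(** Any rearrangement with the same total degree is an instance of the commutation
axiom. *)
Lemma reorders_ex (X : eqType) (d : X -> G) (s s' : seq X) :
  s != [::] -> perm_eq s s' -> (\prod_(x <- s) d x = \prod_(x <- s') d x)%g ->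
  exists c, reorders d s s' c.
Proof.
move=> s0 ss' dd; have n0 : (0 < size s)%N by rewrite lt0n size_eq0.
have /tuple_permP[p s'E] : perm_eq s' (in_tuple s) by rewrite perm_sym.
pose g := map_tuple d (in_tuple s).
have permE (T : Type) (f : X -> T) :
    permute (map_tuple f (in_tuple s)) p = map f s' :> seq T.
  by rewrite s'E /= -map_comp; apply: eq_map => i; rewrite /= tnth_map.
have pS : p \in SymOf g.
  rewrite inE; apply/eqP; rewrite permE !big_map; exact: dd.
have [_ cP] := regular_commutation regA n0 pS.
exists (theta g p) => a ha; have := cP (map_tuple a (in_tuple s)).
by rewrite permE; apply=> i; rewrite !tnth_map.
Qed.

Lemma reorders_sim (X : eqType) (d : X -> G) (s s' : seq X) c a :
  s != [::] -> perm_eq s s' -> reorders d s s' c -> assigned d a ->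
  sim c (map a s) (map a s').
Proof.
move=> s0 ss' cP ha x; rewrite -!(mul_mulseq).
- by rewrite cP // linearZr_LR.
- by rewrite -size_eq0 size_map -(perm_size ss') size_eq0.
- by rewrite -size_eq0 size_map size_eq0.
Qed.

(** The scalar of the commutation axiom, for words over any alphabet of letters with
degrees d, all independent of the elements of A put in place of the letters. *)
Definition reorder_coef (X : eqType) (d : X -> G) (s s' : seq X) : F :=
  xget 0 (reorders d s s').

Lemma reorder_coefP (X : eqType) (d : X -> G) (s s' : seq X) :
  s != [::] -> perm_eq s s' -> (\prod_(x <- s) d x = \prod_(x <- s') d x)%g ->
  reorders d s s' (reorder_coef d s s').
Proof.
by move=> s0 ss' dd; apply: (@xgetPex _ 0 (reorders d s s')); exact: reorders_ex.
Qed.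

Lemma reorder_coef_sim (X : eqType) (d : X -> G) (s s' : seq X) a :
  s != [::] -> perm_eq s s' -> (\prod_(x <- s) d x = \prod_(x <- s') d x)%g ->
  assigned d a -> sim (reorder_coef d s s') (map a s) (map a s').
Proof. by move=> s0 ss' dd; apply: reorders_sim => //; exact: reorder_coefP. Qed.

Lemma reorder_coef_refl (X : eqType) (d : X -> G) (s : seq X) : uniq s -> s != [::] ->
  reorder_coef d s s = 1.
Proof.
move=> us s0; have cP := reorder_coefP s0 (perm_refl s) (erefl (\prod_(x <- s) d x)%g).
have [a [ha a0]] := nonvanishing d us s0.
apply/eqP; rewrite -subr_eq0; have /eqP : (reorder_coef d s s - 1) *: mulseq mul (map a s) = 0.
  by rewrite scalerBl scale1r -cP // subrr.
by rewrite scaler_eq0 (negPf a0) orbF.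
Qed.

Lemma permute2 (T : Type) (y z : T) :
  permute [tuple y; z] (tperm ord0 ord_max) = [:: z; y] :> seq T.
Proof. by rewrite /= enum_ordSl enum_ordSl enum_ord0 /= permE /= permE /= !(tnth_nth y). Qed.

Lemma sim_comm g h a b : (g * h = h * g)%g -> AG g a -> AG h b ->
  sim (theta2 theta g h) [:: a; b] [:: b; a].
Proof.
move=> gh ga hb x.
have [|_ cP] := @regular_commutation _ _ _ _ _ _ regA 2 [tuple g; h] (tperm ord0 ord_max) isT.
  by rewrite inE permute2 !big_cons !big_nil !mulg1 gh.
have := cP [tuple a; b]; rewrite permute2 /= => abE.
rewrite -!mulA abE ?linearZr_LR // => i; case: (unliftP ord0 i) => [j|] ->.
  by rewrite ord1.
by [].
Qed.

Lemma theta2_neq0 g h : (g * h = h * g)%g -> theta2 theta g h != 0.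
Proof.
move=> gh.
have [|//] := @regular_commutation _ _ _ _ _ _ regA 2 [tuple g; h] (tperm ord0 ord_max) isT.
by rewrite inE permute2 !big_cons !big_nil !mulg1 gh.
Qed.

Lemma act_mul x a b w : act x (mul a b :: w) = act x (a :: b :: w).
Proof. by rewrite /= mulA. Qed.

(** Moving a product of two elements of degree 1 past a letter can be done in one
step, with factor theta(1,g), or in two, with factor theta(1,g)^2. *)
Lemma theta2_1l g : theta2 theta 1%g g = 1.
Proof.
have g1 : (1 * g = g * 1)%g by rewrite mulg1 mul1g.
pose d (x : option bool) := if x is Some _ then 1%g else g.
have [a [ha a0]] := nonvanishing_act d (isT : uniq [:: None; Some true; Some false]).
have hab : AG 1%g (mul (a (Some true)) (a (Some false))).
  by have := grading_mul gradA (ha (Some true)) (ha (Some false)); rewrite mulg1.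
have S1 := sim_comm g1 hab (ha None).
have S2 := sim_ctx [:: a (Some true)] [::] (sim_comm g1 (ha (Some false)) (ha None)).
have S3 := sim_ctx [::] [:: a (Some false)] (sim_comm g1 (ha (Some true)) (ha None)).
have := @sim_inj _ _ (theta2 theta 1%g g) _ a0 _ (sim_trans S2 S3).
have t0 := theta2_neq0 g1.
move=> E; apply: (mulfI t0); rewrite mulr1 -E // => x.
by have := S1 x; rewrite act_mul /= mulA.
Qed.

(** Words of degree 1 are central.  All rewritings of words below come down to this,
to [sim_commute], and to inserting or moving factors of degree 1. *)
Lemma sim_central u w g : homw 1%g u -> homw g w -> sim 1 (u ++ w) (w ++ u).
Proof.
have [->|u0] := eqVneq u [::]; first by rewrite cats0 => _ _; exact: sim_refl.
move=> hu; elim: w g => [|b w IHw] g; first by rewrite cats0 => _; exact: sim_refl.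
move=> [h hb hw].
have ub : sim 1 (u ++ [:: b]) ([:: b] ++ u).
  move=> x; have := sim_comm (commute_sym (commute1 h)) (homw_mulseq u0 hu) hb x.
  by rewrite theta2_1l /= mul_mulseq // mul_mulseq // foldl_cat /=.
have := sim_catr w ub; rewrite -!catA /= => /sim1_trans; apply.
exact: (sim_catl [:: b] (IHw _ hw)).
Qed.

Lemma sim_commute u w g h : (g * h = h * g)%g -> u != [::] -> w != [::] ->
  homw g u -> homw h w -> sim (theta2 theta g h) (u ++ w) (w ++ u).
Proof.
move=> gh u0 w0 hu hw x.
have := sim_comm gh (homw_mulseq u0 hu) (homw_mulseq w0 hw) x.
by rewrite /= !mul_mulseq // !foldl_cat.
Qed.

Lemma sim_move_central p u w q g : homw 1%g u -> homw g w ->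
  sim 1 (p ++ u ++ w ++ q) (p ++ w ++ u ++ q).
Proof.
move=> hu hw; have := sim_ctx p q (sim_central hu hw).
by rewrite -!catA.
Qed.

(** * Nested words *)

(** For s = s_1 ... s_n this is k_n ... k_1 m h_1 ... h_n: reading s adds letters on
both sides, so a prefix of s corresponds to an inner word. *)
Definition nest (T I : Type) (k h : I -> T) (s : seq I) (m : seq T) : seq T :=
  rev (map k s) ++ m ++ map h s.

Lemma nest_cons (T I : Type) (k h : I -> T) i s m :
  nest k h (i :: s) m = nest k h s (k i :: m ++ [:: h i]).
Proof. by rewrite /nest /= rev_cons cat_rcons -!catA. Qed.

Lemma nest_cat (T I : Type) (k h : I -> T) s1 s2 m :
  nest k h (s1 ++ s2) m = nest k h s2 (nest k h s1 m).
Proof. by rewrite /nest !map_cat rev_cat -!catA. Qed.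

Definition nested_val (I : Type) (k h : I -> G) (x : G) (s : seq I) : G :=
  foldl (fun y i => k i * y * h i)%g x s.

Lemma nested_valE (I : Type) (k h : I -> G) x s :
  nested_val k h x s = ((\prod_(y <- rev s) k y) * x * \prod_(y <- s) h y)%g.
Proof.
elim: s x => [|i s IHs] x; first by rewrite !big_nil mulg1 mul1g.
by rewrite /= IHs rev_cons -cats1 big_cat big_seq1 big_cons !mulgA.
Qed.

Lemma homw_nest (I : Type) (k h : I -> A) (kd hd : I -> G) s x m :
  assigned kd k -> assigned hd h -> homw x m -> homw (nested_val kd hd x s) (nest k h s m).
Proof.
move=> hk hh hm; rewrite nested_valE -mulgA; apply: homw_cat.
  by rewrite -map_rev; apply: homw_map.
by apply: homw_cat => //; apply: homw_map.
Qed.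

(** A nested word uses two letters for each element of I and one for the center;
this alphabet is option (I + I). *)
Definition letters (T I : Type) (k h : I -> T) (v : T) (x : option (I + I)) : T :=
  match x with None => v | Some (inl i) => k i | Some (inr i) => h i end.

Definition nested_word (I : Type) (s : seq I) : seq (option (I + I)) :=
  nest (fun i => Some (inl i)) (fun i => Some (inr i)) s [:: None].

Lemma map_nested_word (T I : Type) (b : option (I + I) -> T) s :
  map b (nested_word s) =
  nest (fun i => b (Some (inl i))) (fun i => b (Some (inr i))) s [:: b None].
Proof. by rewrite /nested_word /nest map_cat map_rev /= -!map_comp. Qed.

Lemma prod_nested_word (I : Type) (k h : I -> G) v s :
  (\prod_(x <- nested_word s) letters k h v x = nested_val k h v s)%g.
Proof.
rewrite nested_valE /nested_word /nest big_cat big_cons /= big_map -map_rev big_map.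
by rewrite mulgA.
Qed.

Lemma nested_word_neq0 (I : eqType) (s : seq I) : nested_word s != [::].
Proof. by rewrite -size_eq0 /nested_word /nest !size_cat addnS. Qed.

Lemma nested_word_uniq (I : eqType) (s : seq I) : uniq s -> uniq (nested_word s).
Proof.
move=> us; rewrite /nested_word /nest /= cat_uniq rev_uniq /=.
rewrite !map_inj_uniq ?us //=; try by move=> ? ? [].
rewrite andbT negb_or -andbA; apply/and3P; split.
- by rewrite mem_rev; apply/mapP => -[].
- by apply/hasPn => _ /mapP[i _ ->]; rewrite mem_rev; apply/mapP => -[].
- by apply/mapP => -[].
Qed.

Lemma nested_word_perm (I : eqType) (s s' : seq I) : perm_eq s s' ->
  perm_eq (nested_word s) (nested_word s').
Proof.
move=> ss'; rewrite /nested_word /nest; apply: perm_cat.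
  by rewrite perm_rev perm_sym perm_rev perm_sym; apply: perm_map.
by rewrite /= perm_cons perm_map.
Qed.

Lemma assigned_letters (I : Type) (kd hd : I -> G) (vd : G) (k h : I -> A) (v : A) :
  assigned kd k -> assigned hd h -> AG vd v ->
  assigned (letters kd hd vd) (letters k h v).
Proof. by move=> hk hh hv [[i|i]|] /=. Qed.

Section NestedWords.
Context (I : finType).
Implicit Types (s : seq I).

Notation labels := ({ffun I -> G} * {ffun I -> G})%type.

Definition nested_coef (k h : I -> G) (v : G) (s s' : seq I) : F :=
  reorder_coef (letters k h v) (nested_word s) (nested_word s').

Definition is_homw w := exists g, homw g w.

Lemma is_homw_map (X : Type) (d : X -> G) a (s : seq X) : assigned d a -> is_homw (map a s).
Proof. by move=> ha; eexists; apply: homw_map ha. Qed.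

Lemma is_homw_cat w u : is_homw w -> is_homw u -> is_homw (w ++ u).
Proof. by move=> [g gw] [h hu]; exists (g * h)%g; apply: homw_cat. Qed.

Lemma is_homw1 g a : AG g a -> is_homw [:: a].
Proof. by move=> ga; exists g; apply: homw1. Qed.

Lemma sim_move p u w q : homw 1%g u -> is_homw w ->
  sim 1 (p ++ u ++ w ++ q) (p ++ w ++ u ++ q).
Proof. by move=> hu [g hw]; exact: (sim_move_central p q hu hw). Qed.

Lemma nested_coef_sim k h v s s' (ka ha : I -> A) (va : A) :
  perm_eq s s' -> nested_val k h v s = nested_val k h v s' ->
  assigned k ka -> assigned h ha -> AG v va ->
  sim (nested_coef k h v s s') (nest ka ha s [:: va]) (nest ka ha s' [:: va]).
Proof.
move=> ss' ge hk hh hv.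
have := @reorder_coef_sim _ (letters k h v) (nested_word s) (nested_word s')
  (letters ka ha va) (nested_word_neq0 s) (nested_word_perm ss').
rewrite !prod_nested_word !map_nested_word; apply => //.
exact: assigned_letters.
Qed.

Lemma nonvanishing_nest k h v s (Z : eqType) (e : Z -> G) (t : seq Z) : uniq s -> uniq t ->
  exists ka ha va b, [/\ assigned k ka, assigned h ha, AG v va, assigned e b &
    exists y, act y (map b t ++ nest ka ha s [:: va]) != 0].
Proof.
move=> us ut; have [b [a [hb ha a0]]] := nonvanishing_act2 e (letters k h v) ut
  (nested_word_uniq us).
exists (fun i => a (Some (inl i))), (fun i => a (Some (inr i))), (a None), b.
split=> //; try by [move=> i; have := ha (Some (inl i))|move=> i; have := ha (Some (inr i))].
  exact: (ha None).
by have [y y0] := a0; exists y; rewrite -map_nested_word.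
Qed.

(** Multiplying the center by c on the left.  Put a letter J of degree K'^-1 in
front, where K and K' are the products of the k in the two orders: then c has to
cross J K, of degree z, on one side and the central word J K' on the other. *)
Lemma nested_coef_translate k h v c s s' : uniq s -> perm_eq s s' ->
  let z := ((\prod_(i <- rev s') k i)^-1 * \prod_(i <- rev s) k i)%g in
  (z * c = c * z)%g -> nested_val k h v s = nested_val k h v s' ->
  nested_val k h (c * v)%g s = nested_val k h (c * v)%g s' ->
  nested_coef k h (c * v)%g s s' = theta2 theta z c * nested_coef k h v s s'.
Proof.
move=> us ss' z zc ge ge'; have us' : uniq s' by rewrite -(perm_uniq ss').
(* true is the letter c to be inserted, false the letter J. *)
pose e (b : bool) := if b then c else ((\prod_(i <- rev s') k i)^-1)%g.
have [ka [ha [va [b [hk hh hv hb nz]]]]] :=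
  nonvanishing_nest k h v e us' (isT : uniq [:: true; false]).
have hC : AG c (b true) := hb true.
have hJ := hb false; rewrite /e in hJ.
apply: (sim_inj nz (w := b false :: nest ka ha s [:: b true; va])).
  have CV : AG (c * v)%g (mul (b true) va) by exact: (grading_mul gradA hC hv).
  have T := nested_coef_sim ss' ge' hk hh CV.
  have R p q : sim 1 (p ++ [:: mul (b true) va] ++ q) (p ++ [:: b true; va] ++ q).
    by apply: sim_ctx => y; rewrite scale1r /= mulA.
  apply: (sim1_trans (w2 := b false :: nest ka ha s [:: mul (b true) va])).
    exact: (sim_catl [:: b false] (sim1_sym (R _ _))).
  apply: sim_trans1; first exact: (sim_catl [:: b false] T).
  apply: sim1_trans; first exact: (sim_catl [:: b false] (R _ _)).
  have hJK : homw 1%g (b false :: rev (map ka s')).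
    rewrite -(mulVg (\prod_(i <- rev s') k i)%g); apply: homw_cons => //.
    by rewrite -map_rev; apply: homw_map.
  have hC' : is_homw [:: b true] by apply: is_homw1 hC.
  exact: (sim_move [::] (va :: map ha s') hJK hC').
have hJK : homw z (b false :: rev (map ka s)).
  by apply: homw_cons => //; rewrite -map_rev; apply: homw_map.
have S1 : sim (theta2 theta z c) ((b false :: rev (map ka s)) ++ [:: b true])
    ([:: b true] ++ b false :: rev (map ka s)).
  exact: (sim_commute zc _ _ hJK (homw1 hC)).
have := sim_catr (va :: map ha s) S1; rewrite /= -!catA /= => /sim_trans; apply.
exact: (sim_catl [:: b true; b false] (nested_coef_sim ss' ge hk hh hv)).
Qed.

(** Changing the letters at i so that the edge k_i v h_i is preserved.  The inner
words at i have degrees v along s and w along s'.  Inserting a pair P J of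
degrees v and v^-1, one extracts the central word S P T J from both sides; along
s the new letter T crosses J and an inner word of total degree 1, along s' it
crosses a word of degree v^-1 w, whence the factor. *)
Lemma nested_coef_shift k h x t i p1 p2 q1 q2 :
  let s := p1 ++ i :: p2 in let s' := q1 ++ i :: q2 in
  let v := nested_val k h x p1 in let w := nested_val k h x q1 in
  let k' := fun j => if j == i then (k j * (v * t^-1 * v^-1))%g else k j in
  let h' := fun j => if j == i then (t * h j)%g else h j in
  uniq s -> perm_eq s s' -> (v^-1 * w * t = t * (v^-1 * w))%g ->
  nested_val k h x s = nested_val k h x s' -> nested_val k' h' x s = nested_val k' h' x s' ->
  nested_coef k h x s s' = nested_coef k' h' x s s' * theta2 theta (v^-1 * w)%g t.
Proof.
move=> s s' v w k' h' us ss' rt ge ge'; have us' : uniq s' by rewrite -(perm_uniq ss').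
have [ip1 ip2] : i \notin p1 /\ i \notin p2.
  by move: us; rewrite /s cat_uniq /= negb_or => /and3P[_ /andP[-> _] /andP[->]].
have [iq1 iq2] : i \notin q1 /\ i \notin q2.
  by move: us'; rewrite /s' cat_uniq /= negb_or => /and3P[_ /andP[-> _] /andP[->]].
(* The degrees of S, P, T and J, in this order. *)
pose e (b : bool * bool) := match b with
  | (true, true) => (v * t^-1 * v^-1)%g | (true, false) => v
  | (false, true) => t | (false, false) => (v^-1)%g end.
have [ka [ha [va [b [hk hh hv hb nz]]]]] := nonvanishing_nest k h x e us'
  (isT : uniq [:: (true, true); (true, false); (false, true); (false, false)]).
set S := b (true, true) in nz; set P := b (true, false) in nz.
set T := b (false, true) in nz; set J := b (false, false) in nz.
have hS : AG (v * t^-1 * v^-1)%g S := hb (true, true).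
have hP : AG v P := hb (true, false).
have hT : AG t T := hb (false, true).
have hJ : AG (v^-1)%g J := hb (false, false).
pose ka' j := if j == i then mul (ka j) S else ka j.
pose ha' j := if j == i then mul T (ha j) else ha j.
have hk' : assigned k' ka'.
  by move=> j; rewrite /k' /ka'; case: eqP => // _; exact: (grading_mul gradA).
have hh' : assigned h' ha'.
  by move=> j; rewrite /h' /ha'; case: eqP => // _; exact: (grading_mul gradA).
have homs_ka r : is_homw (rev (map ka r)) by rewrite -map_rev; exact: is_homw_map hk.
have nestE r1 r2 : nest ka ha (r1 ++ i :: r2) [:: va] =
    rev (map ka r2) ++ ka i :: nest ka ha r1 [:: va] ++ ha i :: map ha r2.
  by rewrite nest_cat nest_cons {1}/nest /= -!catA.
have nestE' r1 r2 : i \notin r1 -> i \notin r2 ->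
    sim 1 (nest ka' ha' (r1 ++ i :: r2) [:: va])
      (rev (map ka r2) ++ ka i :: S :: nest ka ha r1 [:: va] ++ T :: ha i :: map ha r2).
  move=> i1 i2; rewrite nest_cat nest_cons {1}/nest.
  have kE r : i \notin r -> map ka' r = map ka r.
    by move=> ir; apply/eq_in_map => j jr; rewrite /ka'; case: eqP jr ir => // -> ->.
  have hE r : i \notin r -> map ha' r = map ha r.
    by move=> ir; apply/eq_in_map => j jr; rewrite /ha'; case: eqP jr ir => // -> ->.
  rewrite /nest !kE // !hE // /ka' /ha' eqxx => y; rewrite scale1r.
  by rewrite !foldl_cat /= ?foldl_cat /= ?foldl_cat /= !mulA.
(* Both sides at once: only the way T crosses J and the inner word differs. *)
have key r1 r2 c : i \notin r1 -> i \notin r2 ->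
    sim c (P :: J :: nest ka ha r1 [:: va] ++ [:: T]) (P :: T :: J :: nest ka ha r1 [:: va]) ->
    sim c (P :: J :: nest ka' ha' (r1 ++ i :: r2) [:: va])
      (S :: P :: T :: J :: nest ka ha (r1 ++ i :: r2) [:: va]).
  move=> i1 i2 Sc; rewrite nestE.
  apply: sim1_trans; first exact: (sim_catl [:: P; J] (nestE' _ _ i1 i2)).
  move: (nest ka ha r1 _) Sc => N Sc; set K := rev _; set H := map ha r2.
  have PJ : homw 1%g [:: P; J].
    by rewrite -(mulgV v); apply: homw_cons => //; apply: homw1.
  have hK : is_homw (K ++ [:: ka i; S]).
    apply: is_homw_cat; first exact: homs_ka.
    by exists (k i * (v * t^-1 * v^-1))%g; apply: homw_cons => //; apply: homw1.
  have := sim_move [::] (N ++ T :: ha i :: H) PJ hK.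
  rewrite /= -!catA /= => /sim1_trans; apply.
  have := sim_ctx (K ++ [:: ka i; S]) (ha i :: H) Sc.
  rewrite -!catA /= -!catA /= => /sim_trans1; apply.
  have hE : homw 1%g [:: S; P; T; J].
    have -> : (1 = v * t^-1 * v^-1 * (v * (t * v^-1)))%g by rewrite !mulgA mulgKV mulgKV mulgV.
    by do 3!(apply: homw_cons => //); apply: homw1.
  have hK' : is_homw (K ++ [:: ka i]) by apply: is_homw_cat; [exact: homs_ka|exact:
    is_homw1 (hk i)].
  have := sim1_sym (sim_move [::] (N ++ ha i :: H) hE hK').
  by rewrite /= -!catA /= => /sim1_trans; apply; exact: sim_refl.
have W1 : sim 1 (P :: J :: nest ka' ha' s [:: va]) (S :: P :: T :: J :: nest ka ha s [:: va]).
  apply: key => //.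
  have JN : homw 1%g (J :: nest ka ha p1 [:: va]).
    by rewrite -(mulVg v); apply: homw_cons => //; apply: homw_nest => //; apply: homw1.
  have := sim_move [:: P] [::] JN (is_homw1 hT).
  by rewrite /= -!catA !cats0.
have W2 : sim (theta2 theta (v^-1 * w)%g t) (P :: J :: nest ka' ha' s' [:: va])
    (S :: P :: T :: J :: nest ka ha s' [:: va]).
  apply: key => //.
  have JN : homw (v^-1 * w)%g (J :: nest ka ha q1 [:: va]).
    by apply: homw_cons => //; apply: homw_nest => //; apply: homw1.
  exact: (sim_catl [:: P] (sim_commute rt _ _ JN (homw1 hT))).
apply: (sim_inj nz (w := P :: J :: nest ka' ha' s [:: va])).
  apply: sim1_trans W1 _.
  exact: (sim_catl [:: S; P; T; J] (nested_coef_sim ss' ge hk hh hv)).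
apply: sim_trans W2.
exact: (sim_catl [:: P; J] (nested_coef_sim ss' ge' hk' hh' hv)).
Qed.

(** * Nested words along a walk *)

(** Blocks of degree 1 may be rearranged freely. *)
Lemma sim_perm_central (X : eqType) (b : X -> seq A) (s s' : seq X) :
  (forall x, x \in s -> homw 1%g (b x)) -> perm_eq s s' ->
  sim 1 (flatten (map b s)) (flatten (map b s')).
Proof.
elim: s s' => [|x s IHs] s' hb ss'.
  by move: ss'; rewrite perm_sym => /perm_nilP ->; exact: sim_refl.
have xs' : x \in s' by rewrite -(perm_mem ss') mem_head.
case/splitPr: xs' ss' => p q ss'.
have {}ss' : perm_eq s (p ++ q).
  by rewrite -(perm_cons x); apply: (perm_trans ss'); apply/seq.permP => a; rewrite /=
    !count_cat /=; lia.
have hbs z : z \in s -> homw 1%g (b z) by move=> zs; apply: hb; rewrite inE zs orbT.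
rewrite map_cat flatten_cat /=.
apply: sim1_trans; first exact: (sim_catl (b x) (IHs _ hbs ss')).
rewrite map_cat flatten_cat.
have hp : is_homw (flatten (map b p)).
  have : {subset p <= s} by move=> z zp; rewrite (perm_mem ss') mem_cat zp.
  elim: p {ss'} => [|z p IHp] ps; first by exists 1%g.
  apply: is_homw_cat; first by exists 1%g; apply: hbs; apply: ps; rewrite mem_head.
  by apply: IHp => z' z'p; apply: ps; rewrite inE z'p orbT.
exact: (sim_move [::] (flatten (map b q)) (hb x (mem_head x s)) hp).
Qed.

Definition transp (X : eqType) (x y z : X) := if z == x then y else if z == y then x else z.

(** Exchanging two letters of equal degree gives a sign: the assignment with the two
elements exchanged is again admissible, so the scalar squares to 1. *)
Lemma sim_transp (X : eqType) (d : X -> G) (x y : X) (p q : seq X) :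
  uniq (x :: p ++ y :: q) -> d x = d y ->
  exists2 c, c * c = 1 & forall a, assigned d a ->
    sim c (map a (x :: p ++ y :: q)) (map a (y :: p ++ x :: q)).
Proof.
set s := x :: _; set s' := y :: _ => us dxy.
have ss' : perm_eq s s'.
  by apply/seq.permP => a; rewrite /s /s' /= !count_cat /=; lia.
have dd : (\prod_(z <- s) d z = \prod_(z <- s') d z)%g.
  by rewrite /s /s' !(big_cons, big_cat) /= dxy.
have [c cP] := reorders_ex (isT : s != [::]) ss' dd.
have S a : assigned d a -> sim c (map a s) (map a s').
  exact: (reorders_sim (isT : s != [::]) ss' cP).
exists c; last exact: S.
have [a [ha a0]] := nonvanishing_act d us.
pose a' := a \o transp x y.
have ha' : assigned d a'.
  move=> z; rewrite /a' /= /transp; case: eqP => [->|_]; first by rewrite dxy.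
  by case: eqP => [->|_]; rewrite -?dxy.
have : uniq s by []; rewrite /s /= mem_cat inE !negb_or cat_uniq /= negb_or.
move=> /andP[/and3P[xp xy xq]] /and3P[_ /andP[yp _] /andP[yq _]].
have fixE r : x \notin r -> y \notin r -> map a' r = map a r.
  move=> xr yr; apply/eq_in_map => z zr; rewrite /a' /= /transp.
  by case: eqP zr xr => [->->//|_ zr _]; case: eqP zr yr => [->->|].
have txy : transp x y x = y by rewrite /transp eqxx.
have tyx : transp x y y = x by rewrite /transp eqxx eq_sym (negPf xy).
have sE : map a' s = map a s'.
  by rewrite /s /s' /= !map_cat /= !fixE // /a' /= txy tyx.
have s'E : map a' s' = map a s.
  by rewrite /s /s' /= !map_cat /= !fixE // /a' /= txy tyx.
have S' := S _ ha'; rewrite sE s'E in S'.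
by apply: (sim_inj a0 (sim_trans (S _ ha) S')) (sim_refl _).
Qed.

(** By transpositions of letters of equal degree, one for each position. *)
Lemma sim_same_degrees (X : eqType) (d : X -> G) (s s' : seq X) :
  uniq s -> perm_eq s s' -> map d s = map d s' ->
  exists2 c, c * c = 1 & forall a, assigned d a -> sim c (map a s) (map a s').
Proof.
elim: s s' => [|x s IHs] [|y s'] //.
- by move=> _ _ _; exists 1; rewrite ?mulr1 // => a _; exact: sim_refl.
move=> us ss' [dxy dss']; have [xy|xy] := eqVneq x y.
  rewrite -xy perm_cons in ss' *.
  have [|c cc S] := IHs s' _ ss' dss'; first by case/andP: us.
  by exists c => // a ha; exact: (sim_catl [:: a x] (S _ ha)).
have xs' : x \in s'.
  by have := perm_mem ss' x; rewrite mem_head inE (negPf xy) => /esym.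
case/splitPr: xs' ss' dss' => p q ss' dss'.
have ss'' : perm_eq s (p ++ y :: q).
  rewrite -(perm_cons x); apply: (perm_trans ss').
  by apply/seq.permP => a; rewrite /= !count_cat /=; lia.
have [||c cc S] := IHs (p ++ y :: q) _ ss''; first by case/andP: us.
  by rewrite dss' !map_cat /= dxy.
have us'' : uniq (x :: p ++ y :: q) by rewrite -(perm_uniq (s1 := x :: s)) // perm_cons.
have [c' cc' S'] := sim_transp us'' dxy.
exists (c * c'); first by rewrite mulrACA cc cc' mulr1.
by move=> a ha; apply: sim_trans (S' _ ha); exact: (sim_catl [:: a x] (S _ ha)).
Qed.

(** v_i and u_i being the two ends of an edge i, the edges s_1, ..., s_n form a walk
from x to e.  The single equation of sequences says at once that the walk starts
at x, that each edge starts where the previous one ends, and that the last one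
ends at e. *)
Definition chain (v u : I -> G) (e x : G) s := rcons (map v s) e == x :: map u s.

Lemma chain_cons v u e x i s :
  chain v u e x (i :: s) = (v i == x) && chain v u e (u i) s.
Proof. by rewrite /chain /= eqseq_cons. Qed.

Lemma chain_cat v u e x s1 s2 : chain v u e x (s1 ++ s2) ->
  chain v u e (last x (map u s1)) s2.
Proof. by elim: s1 x => [|i s1 IHs1] x //=; rewrite chain_cons => /andP[_ /IHs1]. Qed.

(** The inner word after a prefix of s has the value reached by the walk. *)
Lemma nested_val_chain (k h v u : I -> G) e x s1 s2 :
  (forall i, u i = k i * v i * h i)%g -> chain v u e x (s1 ++ s2) ->
  nested_val k h x s1 = last x (map u s1).
Proof.
move=> uE; elim: s1 x => [|i s1 IHs1] x //=.
by rewrite chain_cons => /andP[/eqP <- /IHs1]; rewrite -uE.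
Qed.

Lemma chain_last v u e x s : chain v u e x s -> last x (map u s) = e.
Proof. by move/eqP/(congr1 (last x)); rewrite last_rcons. Qed.

Lemma nested_val_chain_end (k h v u : I -> G) e x s :
  (forall i, u i = k i * v i * h i)%g -> chain v u e x s -> nested_val k h x s = e.
Proof.
by move=> uE c; rewrite -(chain_last c) (@nested_val_chain k h v u e x s [::]) ?cats0.
Qed.

Section Regroup.
Context (k h v u : I -> G) (x e : G) (ka ha va : I -> A) (b : option I -> A).
Hypothesis uE : forall i, (u i = k i * v i * h i)%g.
Let bd (o : option I) : G := if o is Some i then (v i)^-1%g else e^-1%g.
Hypotheses (hk : assigned k ka) (hh : assigned h ha) (hv : assigned v va) (hb : assigned bd b).

Let pairs s := flatten [seq [:: b (Some i); va i] | i <- s].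
Let edges s := flatten [seq [:: b (Some i); ka i; va i; ha i] | i <- s].

Lemma homw_pair i : homw 1%g [:: b (Some i); va i].
Proof.
by rewrite -(mulVg (v i)); apply: homw_cons; [exact: (hb (Some i))|exact: homw1].
Qed.

(** The pairs b_i v_i are central.  Inserted next to the inner words, they cut the
nested word into the consecutive edges b_i k_i v_i h_i. *)
Lemma sim_chain_edges y m s : homw y m -> chain v u e y s ->
  sim 1 (nest ka ha s m ++ b None :: pairs s) (m ++ edges s ++ [:: b None]).
Proof.
elim: s y m => [|i s IHs] y m hm.
  by rewrite /nest /= cats0 => _; exact: sim_refl.
rewrite chain_cons => /andP[/eqP vi cs].
have hpair := homw_pair i.
have hmb : homw 1%g (m ++ [:: b (Some i)]).
  rewrite -(mulgV y) -{2}vi; apply: homw_cat => //; apply: homw1; exact: (hb (Some i)).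
have hedge : homw (u i) [:: ka i; va i; ha i].
  rewrite uE -mulgA; apply: homw_cons => //; apply: homw_cons => //; exact: homw1.
have hpost : is_homw (ha i :: map ha s ++ [:: b None]).
  apply: (is_homw_cat (is_homw1 (hh i))); apply: is_homw_cat; first exact: is_homw_map hh.
  exact: (is_homw1 (hb None)).
have hpre : is_homw (rev (map ka s) ++ [:: ka i]).
  by apply: is_homw_cat (is_homw1 (hk i)); rewrite -map_rev; exact: is_homw_map hk.
have S1 := sim1_sym (sim_move (rev (map ka s) ++ ka i :: m) (pairs s) hpair hpost).
have S2 := sim1_sym (sim_move [::] (va i :: ha i :: map ha s ++ b None :: pairs s) hmb hpre).
have S3 := sim_catl (m ++ [:: b (Some i)]) (IHs _ _ hedge cs).
apply: (sim1_trans (w2 := (rev (map ka s) ++ ka i :: m) ++ [:: b (Some i); va i] ++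
   (ha i :: map ha s ++ [:: b None]) ++ pairs s)).
  by move: S1; rewrite /nest /pairs /= rev_cons -cats1 -!catA /= -?catA.
apply: (sim1_trans (w2 := (m ++ [:: b (Some i)]) ++ (rev (map ka s) ++ [:: ka i]) ++
   va i :: ha i :: map ha s ++ b None :: pairs s)).
  by move: S2; rewrite /= -!catA /= -?catA.
by move: S3; rewrite /nest /edges /= -!catA.
Qed.

Context (x0 : A) (hx : AG x x0).
Let block (o : option I) : seq A := if o is Some i then [:: ka i; va i; ha i] else [:: x0].
Let src (o : option I) : G := if o is Some i then v i else e.
Let tgt (o : option I) : G := if o is Some i then u i else x.
Let bword (f : option I -> option I) (S : seq (option I)) : seq A :=
  flatten [seq block o ++ [:: b (f o)] | o <- S].

Lemma homw_block o : homw (tgt o) (block o).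
Proof.
case: o => [i|]; last exact: homw1.
rewrite /tgt /block uE -mulgA; apply: homw_cons => //; apply: homw_cons => //; exact: homw1.
Qed.

Lemma bwordE f s : [seq f o | o <- None :: map Some s] = rcons (map Some s) None ->
  bword f (None :: map Some s) = x0 :: edges s ++ [:: b None].
Proof.
suff gen o : [seq f o' | o' <- o :: map Some s] = rcons (map Some s) None ->
    bword f (o :: map Some s) = block o ++ edges s ++ [:: b None] by exact: (gen None).
rewrite /bword; elim: s o => [|i s IHs] o /=; first by case=> ->; rewrite /= cats0.
by case=> -> /(IHs (Some i)) /= ->; rewrite /edges /= -!catA.
Qed.

Lemma chain_succ s o : uniq s -> chain v u e x s -> o \in None :: map Some s ->
  src (succ_in s o) = tgt o.
Proof.
move=> us /eqP cs; have : map src (map (succ_in s) (None :: map Some s)) =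
    map tgt (None :: map Some s).
  by rewrite map_succ_in // map_rcons /= -!map_comp -cs.
by rewrite -map_comp => /eq_in_map /[apply].
Qed.

Lemma sim_chain_bword s : uniq s -> chain v u e x s ->
  sim 1 (nest ka ha s [:: x0] ++ b None :: pairs s) (bword (succ_in s) (None :: map Some s)).
Proof.
move=> us cs; rewrite bwordE ?map_succ_in //.
by apply: (sim_chain_edges (y := x) (m := [:: x0])) => //; exact: homw1.
Qed.

(** Cut after each b instead of before: the blocks become central. *)
Lemma homw_bblock s o : uniq s -> chain v u e x s -> o \in None :: map Some s ->
  homw 1%g (block o ++ [:: b (succ_in s o)]).
Proof.
move=> us cs os; rewrite -(mulgV (tgt o)); apply: homw_cat; first exact: homw_block.
rewrite -(chain_succ us cs os); apply: homw1.
by case: (succ_in s o) => [i|]; [exact: (hb (Some i))|exact: (hb None)].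
Qed.
End Regroup.

Lemma perm_flatten_pairs (X Y : eqType) (f g : X -> Y) (s : seq X) :
  perm_eq (flatten [seq [:: f o; g o] | o <- s]) (map f s ++ map g s).
Proof.
elim: s => //= o s IHs; apply/seq.permP => a; have /seq.permP/(_ a) := IHs.
by rewrite /= !count_cat /= => ->; lia.
Qed.

(** By [sim_chain_bword] both nested words are, up to the same central factor, made of
central blocks, one for each edge and one for the center.  Put in the same order
the blocks differ only in their last letters b, and the letters b exchanged have
equal degree since both orders follow the same walk. *)
Lemma nested_coef_sqr (k h v u : I -> G) (x e : G) s s' :
  (forall i, u i = k i * v i * h i)%g -> uniq s -> perm_eq s s' ->
  chain v u e x s -> chain v u e x s' -> nested_coef k h x s s' ^+ 2 = 1.
Proof.
move=> uE us ss' cs cs'; have us' : uniq s' by rewrite -(perm_uniq ss').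
pose bd (o : option I) : G := if o is Some i then (v i)^-1%g else e^-1%g.
pose src (o : option I) : G := if o is Some i then v i else e.
pose tgt (o : option I) : G := if o is Some i then u i else x.
pose de z := match z with inl o => bd o | inr i => v i end.
pose t : seq (option I + I) := inl None :: flatten [seq [:: inl (Some i); inr i] | i <- s'].
have ut : uniq t.
  have pt := perm_flatten_pairs (fun i => inl (Some i) : option I + I) inr s'.
  rewrite /t /= (perm_uniq pt) (perm_mem pt) mem_cat negb_or cat_uniq.
  rewrite !map_inj_uniq ?us' /=; try by move=> ? ? [].
  rewrite andbT; apply/andP; split; first by apply/andP; split; apply/mapP => -[].
  by apply/hasPn => _ /mapP[i _ ->]; apply/mapP => -[].
have [a [bv [hab hbv nz]]] := nonvanishing_act2 (letters k h x) de
  (nested_word_uniq us') ut.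
rewrite map_nested_word in nz.
set ka := fun i => a (Some (inl i)) in nz; set ha := fun i => a (Some (inr i)) in nz.
set x0 := a None in nz; pose b o := bv (inl o); pose va i := bv (inr i).
have hk : assigned k ka by move=> i; exact: (hab (Some (inl i))).
have hh : assigned h ha by move=> i; exact: (hab (Some (inr i))).
have hx : AG x x0 := hab None.
have hb : assigned bd b by move=> o; exact: (hbv (inl o)).
have hv : assigned v va by move=> o; exact: (hbv (inr o)).
pose pairs s := flatten [seq [:: b (Some i); va i] | i <- s].
have {}nz : exists y, act y (nest ka ha s' [:: x0] ++ b None :: pairs s') != 0.
  by move: nz; rewrite /t /= map_flatten -map_comp.
pose block (o : option I) : seq A := if o is Some i then [:: ka i; va i; ha i] else [:: x0].
pose bword f (S : seq (option I)) := flatten [seq block o ++ [:: b (f o)] | o <- S].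
set S := None :: map Some s; set S' := None :: map Some s'.
have pS : perm_eq S' S by rewrite perm_cons perm_map // perm_sym.
have W : sim 1 (nest ka ha s [:: x0] ++ b None :: pairs s) (bword (succ_in s) S).
  exact: (sim_chain_bword uE hk hh hv hb hx us cs).
have W' : sim 1 (nest ka ha s' [:: x0] ++ b None :: pairs s') (bword (succ_in s') S).
  apply: (sim1_trans (sim_chain_bword uE hk hh hv hb hx us' cs')).
  by apply: sim_perm_central => // o oS; exact: (homw_bblock uE hk hh hv hb hx us' cs').
(* Letters (true, o) stand for the first part of the block of o, (false, o) for b o. *)
pose dl (z : bool * option I) := if z.1 then tgt z.2 else bd z.2.
pose al (z : bool * option I) := if z.1 then mulseq mul (block z.2) else b z.2.
have hal : assigned dl al.
  move=> [[] o] /=; last exact: hb.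
  apply: homw_mulseq => //; first by case: o.
  exact: (homw_block uE hk hh hv hx).
pose lw f := flatten [seq [:: (true, o); (false, f o)] | o <- S].
have lwE f : sim 1 (bword f S) (map al (lw f)).
  move=> y; rewrite scale1r /bword /lw; elim: S y {pS W W' lw} => //= o T IHT y.
  rewrite !foldl_cat /= IHT; congr (act (mul _ _) _).
  by case: o => [i|] //=; rewrite !mulA.
have mS s1 : uniq s1 -> perm_eq s1 s -> perm_eq (map (succ_in s1) S) S.
  move=> u1 s1s; apply: (@perm_trans _ (map (succ_in s1) (None :: map Some s1))).
    by apply: perm_map; rewrite perm_cons perm_map // perm_sym.
  rewrite map_succ_in //; rewrite -cats1 perm_catC /= perm_cons; exact: perm_map.
have lwP s1 : uniq s1 -> perm_eq s1 s ->
    perm_eq (lw (succ_in s1)) (map (pair true) S ++ map (pair false) S).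
  move=> u1 s1s; apply: (perm_trans (perm_flatten_pairs (pair true) _ S)).
  rewrite perm_cat2l (map_comp (pair false)); exact: perm_map (mS _ u1 s1s).
have s's : perm_eq s' s by rewrite perm_sym.
have US : uniq S := cycle_uniq us.
have lu : uniq (lw (succ_in s)).
  rewrite (perm_uniq (lwP _ us (perm_refl s))) cat_uniq; apply/and3P; split.
  - by rewrite map_inj_uniq // => ? ? [].
  - by apply/hasPn => _ /mapP[i _ ->]; apply/mapP => -[].
  - by rewrite map_inj_uniq // => ? ? [].
have lp : perm_eq (lw (succ_in s)) (lw (succ_in s')).
  by apply: (perm_trans (lwP _ us (perm_refl s))); rewrite perm_sym; exact: lwP.
have ld : map dl (lw (succ_in s)) = map dl (lw (succ_in s')).
  rewrite !map_flatten -!map_comp; congr flatten; apply/eq_in_map => o oS /=.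
  have bdE o' : bd o' = (src o')^-1%g by case: o'.
  have E : src (succ_in s o) = tgt o := chain_succ us cs oS.
  have E' : src (succ_in s' o) = tgt o by apply: (chain_succ us' cs'); rewrite (perm_mem pS).
  by rewrite /dl /= !bdE E E'.
have [c cc cS] := sim_same_degrees lu lp ld.
have <- : c = nested_coef k h x s s'.
  apply: (sim_inj nz (w := nest ka ha s [:: x0] ++ b None :: pairs s)).
    apply: (sim1_trans W); apply: (sim1_trans (lwE _)).
    apply: (sim_trans1 (cS _ hal)); apply: (sim1_trans (sim1_sym (lwE _))).
    exact: sim1_sym W'.
  have ge : nested_val k h x s = nested_val k h x s'.
    by rewrite (nested_val_chain_end uE cs) (nested_val_chain_end uE cs').
  apply: sim_trans1; first exact: (sim_catr _ (nested_coef_sim ss' ge hk hh hx)).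
  apply: (sim_catl _ (sim_catl [:: b None] _)).
  by apply: sim_perm_central => // i _; exact: (homw_pair hv hb).
by rewrite expr2.
Qed.

(** * Correlation sums *)

(** The matrix L of the opening comment. *)
Definition corr (s s' : seq I) : F :=
  \sum_(h : {ffun I -> G} | (\prod_(i <- s) h i == \prod_(i <- s') h i)%g)
    reorder_coef h s s'.

(** The matrix Z of the opening comment. *)
Definition nested_corr (s s' : seq I) : F :=
  \sum_(kh : labels)
    \sum_(v : G | nested_val kh.1 kh.2 v s == nested_val kh.1 kh.2 v s')
      nested_coef kh.1 kh.2 v s s'.

Lemma nested_coef_split (k h : I -> G) v s s' : uniq s -> s != [::] -> perm_eq s s' ->
  (\prod_(i <- rev s) k i = \prod_(i <- rev s') k i)%g ->
  (\prod_(i <- s) h i = \prod_(i <- s') h i)%g ->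
  nested_coef k h v s s' = reorder_coef k (rev s) (rev s') * reorder_coef h s s'.
Proof.
move=> us s0 ss' kE hE; have us' : uniq s' by rewrite -(perm_uniq ss').
have [ka [ha [va [b [hk hh hv hb nz]]]]] :=
  nonvanishing_nest k h v (fun=> 1%g) us' (isT : uniq ([::] : seq bool)).
rewrite /= in nz.
have rs0 : rev s != [::] by rewrite -size_eq0 size_rev size_eq0.
have rss' : perm_eq (rev s) (rev s') by rewrite perm_rev perm_sym perm_rev perm_sym.
apply: (sim_inj nz (w := nest ka ha s [:: va])).
  have ge : nested_val k h v s = nested_val k h v s' by rewrite !nested_valE kE hE.
  exact: (nested_coef_sim ss' ge hk hh hv).
rewrite /nest -!map_rev.
apply: sim_cat; first exact: (reorder_coef_sim rs0 rss' kE hk).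
exact: (sim_catl [:: va] (reorder_coef_sim s0 ss' hE hh)).
Qed.

(** Let z measure the difference between the two products of the k.  If z is not 1,
take c commuting with z with theta(z,c) <> 1: replacing v by c v permutes the
admissible centers and multiplies all terms by theta(z,c), so the sum is 0.  If
z = 1 the two halves separate and every v contributes the same. *)
Lemma sum_nested_coef_center (k h : I -> G) s s' : uniq s -> s != [::] -> perm_eq s s' ->
  \sum_(v : G | nested_val k h v s == nested_val k h v s') nested_coef k h v s s' =
  if (\prod_(i <- rev s) k i == \prod_(i <- rev s') k i)%g &&
     (\prod_(i <- s) h i == \prod_(i <- s') h i)%g
  then #|G|%:R * (reorder_coef k (rev s) (rev s') * reorder_coef h s s') else 0.
Proof.
move=> us s0 ss'; have [kE|kE] /= := eqVneq (\prod_(i <- rev s) k i)%g (\prod_(i <- rev s')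
  k i)%g.
  have condE v : (nested_val k h v s == nested_val k h v s') =
      (\prod_(i <- s) h i == \prod_(i <- s') h i)%g.
    by rewrite !nested_valE kE (inj_eq (mulgI _)).
  under eq_bigl do rewrite condE.
  case: eqP => [hE|_]; last by rewrite big_pred0_eq.
  under eq_bigr do rewrite nested_coef_split //.
  by rewrite sumr_const mulr_natl.
pose z := ((\prod_(i <- rev s') k i)^-1 * \prod_(i <- rev s) k i)%g.
have z1 : z != 1%g.
  by apply: contra kE => /eqP zE; apply/eqP; rewrite -[LHS](mulKVg (\prod_(i <- rev s') k
    i)%g) -/z zE mulg1.
have [c /cent1P cz c1] := ndegA z1.
have zc : (z * c = c * z)%g by rewrite cz.
have gE v : (nested_val k h v s == nested_val k h v s') =
    (z * v * \prod_(i <- s) h i == v * \prod_(i <- s') h i)%g.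
  by rewrite !nested_valE -(inj_eq (mulgI (\prod_(i <- rev s') k i)^-1%g)) !mulgA mulVg mul1g.
set S := \sum_(v | _) _.
have : S = theta2 theta z c * S.
  rewrite {1}/S (reindex_inj (mulgI c)) mulr_sumr.
  have gcE v : (nested_val k h (c * v)%g s == nested_val k h (c * v)%g s') =
      (nested_val k h v s == nested_val k h v s').
    by rewrite !gE !mulgA zc -!mulgA (inj_eq (mulgI c)).
  under eq_bigl do rewrite gcE.
  by apply: eq_bigr => v gv; apply: nested_coef_translate => //; apply/eqP; rewrite ?gcE.
move/eqP; rewrite -subr_eq0 -{1}[S]mul1r -mulrBl mulf_eq0 subr_eq0 eq_sym (negPf c1).
by move=> /eqP.
Qed.

Lemma nested_corr_factor s s' : uniq s -> s != [::] -> perm_eq s s' ->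
  nested_corr s s' = #|G|%:R * (corr (rev s) (rev s') * corr s s').
Proof.
move=> us s0 ss'; rewrite /nested_corr.
under eq_bigr do rewrite sum_nested_coef_center //.
rewrite -(pair_bigA _ (fun k h : {ffun I -> G} => if (\prod_(i <- rev s) k i == \prod_(i <-
  rev s') k i)%g &&
     (\prod_(i <- s) h i == \prod_(i <- s') h i)%g
  then #|G|%:R * (reorder_coef k (rev s) (rev s') * reorder_coef h s s') else 0)) /=.
rewrite /corr mulr_suml mulr_sumr [RHS]big_mkcond; apply: eq_bigr => k _.
case: ifP => kE /=; last by rewrite big1.
by rewrite mulr_sumr mulr_sumr [RHS]big_mkcond.
Qed.

(** The part of [nested_corr] in which the edges are prescribed: i leads from v_i to u_i. *)
Definition edge_sum (v u : I -> G) (x : G) s s' : F :=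
  \sum_(kh : labels |
         [forall i, u i == kh.1 i * v i * kh.2 i]%g &&
         (nested_val kh.1 kh.2 x s == nested_val kh.1 kh.2 x s')) nested_coef kh.1 kh.2 x s s'.

(** At i the walk along s' is at y and not at the start of the edge i.  Take t
commuting with r = v_i^-1 y with theta(r,t) <> 1; shifting the letters at i by t
keeps all edges and permutes the terms, which [nested_coef_shift] multiplies by
a constant other than 1. *)
Lemma edge_sum_step (v u : I -> G) e x i p1 p2 q1 q2 y :
  let s := p1 ++ i :: p2 in let s' := q1 ++ i :: q2 in
  uniq s -> perm_eq s s' -> chain v u e x s -> v i != y ->
  (forall k h : I -> G, (forall i, u i = k i * v i * h i)%g -> nested_val k h x q1 = y) ->
  edge_sum v u x s s' = 0.
Proof.
move=> s s' us ss' cs vy q1y; pose r := ((v i)^-1 * y)%g.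
have r1 : r != 1%g by apply: contra vy => /eqP rE; apply/eqP; rewrite -[y](mulKVg (v i))
  -/r rE mulg1.
have [t /cent1P tr t1] := ndegA r1.
have us' : uniq s' by rewrite -(perm_uniq ss').
have iq1 : i \notin q1.
  by move: us'; rewrite /s' cat_uniq /= negb_or => /and3P[_ /andP[-> _]].
have iq2 : i \notin q2.
  by move: us'; rewrite /s' cat_uniq /= => /and4P[].
pose phi (kh : labels) : labels :=
  ([ffun j => if j == i then kh.1 j * (v i * t^-1 * (v i)^-1) else kh.1 j]%g,
   [ffun j => if j == i then t * kh.2 j else kh.2 j]%g).
have phiI : injective phi.
  move=> [k h] [k' h'] [/ffunP kE /ffunP hE].
  congr (_, _); apply/ffunP => j.
    by have := kE j; rewrite !ffunE; case: eqP => // _ /mulIg.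
  by have := hE j; rewrite !ffunE; case: eqP => // _ /mulgI.
have edgeE kh j : ((phi kh).1 j * v j * (phi kh).2 j = kh.1 j * v j * kh.2 j)%g.
  by rewrite !ffunE; case: eqP => [->|//]; rewrite !mulgA mulgKV mulgKV.
set S := edge_sum _ _ _ _ _.
have : S = S * theta2 theta r t.
  rewrite {2}/S /edge_sum (reindex_inj phiI) mulr_suml.
  have condE (kh : labels) : [forall j, u j == (phi kh).1 j * v j * (phi kh).2 j]%g =
      [forall j, u j == kh.1 j * v j * kh.2 j]%g.
    by apply: eq_forallb => j; rewrite edgeE.
  have gE (kh : labels) : [forall j, u j == kh.1 j * v j * kh.2 j]%g ->
      nested_val (phi kh).1 (phi kh).2 x s' = nested_val kh.1 kh.2 x s'.
    move=> ukh; have uE j : (u j = kh.1 j * v j * kh.2 j)%g := eqP (forallP ukh j).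
    have uE' j : (u j = (phi kh).1 j * v j * (phi kh).2 j)%g by rewrite edgeE.
    rewrite /nested_val /s' !foldl_cat /= -!/(nested_val _ _ _ _) (q1y _ _ uE) (q1y _ _ uE').
    have -> : ((phi kh).1 i * y * (phi kh).2 i = kh.1 i * y * kh.2 i)%g.
      rewrite !ffunE eqxx; have yE : (y = v i * r)%g by rewrite mulKVg.
      move: r tr yE {r1 t1} => r tr ->; rewrite !mulgA mulgKV.
      by rewrite -(mulgA _ r) -tr !mulgA mulgKV.
    elim: q2 iq2 (kh.1 i * y * _)%g {cs us us' ss' s' S} => //= j q IHq.
    rewrite inE negb_or => /andP[ij iq] w; rewrite !ffunE eq_sym (negPf ij); exact: IHq.
  apply: eq_big => [kh|kh /andP[ukh /eqP gs]]; rewrite ?condE.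
    case: (boolP [forall j, _]) => //= ukh; rewrite gE //.
    have uE j : (u j = kh.1 j * v j * kh.2 j)%g := eqP (forallP ukh j).
    have uE' j : (u j = (phi kh).1 j * v j * (phi kh).2 j)%g by rewrite edgeE.
    by rewrite (nested_val_chain_end uE cs) (nested_val_chain_end uE' cs).
  have uE j : (u j = kh.1 j * v j * kh.2 j)%g := eqP (forallP ukh j).
  have uE' j : (u j = (phi kh).1 j * v j * (phi kh).2 j)%g by rewrite edgeE.
  have p1v : nested_val kh.1 kh.2 x p1 = v i.
    rewrite (nested_val_chain uE cs); have := chain_cat cs.
    by rewrite chain_cons => /andP[/eqP].
  have := @nested_coef_shift kh.1 kh.2 x t i p1 p2 q1 q2.
  rewrite p1v (q1y _ _ uE) => /(_ us ss').
  have rt : (r * t = t * r)%g by rewrite tr.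
  have -> : (fun j => if j == i then kh.1 j * (v i * t^-1 * (v i)^-1) else kh.1 j)%g = (phi
    kh).1.
    by apply/funext => j; rewrite ffunE.
  have -> : (fun j => if j == i then t * kh.2 j else kh.2 j)%g = (phi kh).2.
    by apply/funext => j; rewrite ffunE.
  apply=> //; rewrite -/s -/s' gE //.
  by rewrite (nested_val_chain_end uE' cs) -(nested_val_chain_end uE cs).
move/eqP; rewrite -subr_eq0 -{1}[S]mulr1 -mulrBr mulf_eq0 (subr_eq0 1) [1 == _]eq_sym
  (negPf t1) orbF.
by move=> /eqP.
Qed.

(** Follow s' up to the first letter where it leaves the walk. *)
Lemma edge_sum_chain (v u : I -> G) e x s s' : uniq s -> perm_eq s s' ->
  chain v u e x s -> ~~ chain v u e x s' -> edge_sum v u x s s' = 0.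
Proof.
move=> us ss' cs; suff gen q2 : forall q1 y, s' = q1 ++ q2 ->
    (forall k h : I -> G, (forall i, u i = k i * v i * h i)%g -> nested_val k h x q1 = y) ->
    ~~ chain v u e y q2 -> edge_sum v u x s s' = 0.
  by apply: (gen s' [::] x).
elim: q2 => [|i q2 IHq] q1 y s'E q1y.
  rewrite /chain /= eqseq_cons andbT => ey; rewrite /edge_sum big_pred0 // => kh.
  apply/negP => /andP[/forallP ukh /eqP].
  have uE j : (u j = kh.1 j * v j * kh.2 j)%g := eqP (ukh j).
  rewrite (nested_val_chain_end uE cs) s'E cats0 (q1y _ _ uE) => /eqP.
  by rewrite (negPf ey).
rewrite chain_cons; have [viy|viy] := eqVneq (v i) y => /=.
  apply: (IHq (rcons q1 i)); first by rewrite cat_rcons.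
  by move=> k h uE; rewrite /nested_val foldl_rcons -/(nested_val _ _ _ _) (q1y _ _ uE) uE viy.
move=> _; have is_ : i \in s by rewrite (perm_mem ss') s'E mem_cat mem_head orbT.
case/splitPr: is_ us ss' cs => p1 p2 us ss' cs; rewrite s'E in ss' *.
exact: (edge_sum_step us ss' cs viy q1y).
Qed.

Lemma int_of_signs (T : finType) (P : pred T) (f : T -> F) :
  (forall t, P t -> f t ^+ 2 = 1) ->
  exists2 z : int, z%:~R = \sum_(t | P t) f t & `|z| <= #|[pred t | P t]|%:R.
Proof.
move=> f1; exists (\sum_(t | P t) (-1) ^+ (f t != 1)).
  rewrite rmorph_sum; apply: eq_bigr => t Pt; rewrite rmorphXn rmorphN1.
  have /eqP := f1 t Pt; rewrite sqrf_eq1 => /orP[] /eqP ->; first by rewrite eqxx.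
  by case: eqP.
apply: le_trans (ler_norm_sum _ _ _) _; rewrite -sum1_card natr_sum.
by apply: ler_sum => t _; rewrite normrX normrN1 expr1n.
Qed.

(** Prescribed edges determine h from k, so there are at most |G|^n terms, all signs. *)
Lemma edge_sum_int (v u : I -> G) e x s s' : uniq s -> perm_eq s s' ->
  chain v u e x s -> chain v u e x s' ->
  exists2 z : int, z%:~R = edge_sum v u x s s' & `|z| <= (#|G| ^ #|I|)%:R.
Proof.
move=> us ss' cs cs'.
have [kh /andP[/forallP ukh _]|z zE zle] := @int_of_signs _ (fun kh : labels =>
   [forall i, u i == kh.1 i * v i * kh.2 i]%g && (nested_val kh.1 kh.2 x s == nested_val
     kh.1 kh.2 x s'))
  (fun kh => nested_coef kh.1 kh.2 x s s').
  have uE j : (u j = kh.1 j * v j * kh.2 j)%g := eqP (ukh j).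
  exact: (nested_coef_sqr uE us ss' cs cs').
exists z => //; apply: (le_trans zle); rewrite ler_nat -card_ffun.
set Q := [pred kh | _]; have fstI : {in Q &, injective (fun kh : labels => kh.1)}.
  move=> [k h] [k' h'] /andP[/= /forallP kh _] /andP[/= /forallP kh' _] kk'; subst k'.
  congr (_, _); apply/ffunP => i; have /eqP := kh i; rewrite (eqP (kh' i)).
  by move/mulgI.
by rewrite -(card_in_imset fstI) max_card.
Qed.

(** The values of the inner words form a walk along s. *)
Lemma nested_val_scan (k h : I -> G) x s : uniq s ->
  chain (fun i => nested_val k h x (take (index i s) s))
    (fun i => k i * nested_val k h x (take (index i s) s) * h i)%g (nested_val k h x s) x s.
Proof.
move=> us; apply/eqP; apply: (@eq_from_nth _ 1%g); first by rewrite /= size_rcons !size_map.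
move=> j; rewrite size_rcons size_map ltnS => lej.
case: s us lej => [|i0 s]; first by case: j.
set s1 := i0 :: s => us lej.
have -> : nth 1%g (rcons [seq nested_val k h x (take (index i s1) s1) | i <- s1]
  (nested_val k h x s1)) j =
    nested_val k h x (take j s1).
  rewrite nth_rcons size_map; case: ltngtP lej => // [lt|->] _.
    by rewrite (nth_map i0) // index_uniq.
  by rewrite take_size.
case: j lej => [|j] lej; first by rewrite take0.
rewrite -[RHS]/(nth 1%g (map _ s1) j) (nth_map i0) // index_uniq //.
by rewrite (take_nth i0) // /nested_val foldl_rcons.
Qed.

(** A walk is stored as a function P on option I: P (Some i) is the start of the
edge i and P None the end of the walk. *)
Definition walk_src (P : {ffun option I -> G}) i := P (Some i).
Definition walk_tgt s (P : {ffun option I -> G}) i := P (succ_in s (Some i)).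

(** Both sequences compared in [chain] are P read along None, s'_1, ..., s'_n: on one
side after the successor in s', on the other after the successor in s. *)
Lemma chain_walk s s' (P : {ffun option I -> G}) :
  uniq s -> uniq s' -> (forall i, i \in s') ->
  chain (walk_src P) (walk_tgt s P) (P None) (P (succ_in s None)) s' =
  [forall o, P (succ_in s' o) == P (succ_in s o)].
Proof.
move=> us us' s'I; rewrite /chain.
have -> : rcons [seq walk_src P i | i <- s'] (P None) = [seq P (succ_in s' o) | o <- None
  :: map Some s'].
  by rewrite (map_comp P (succ_in s')) map_succ_in // map_rcons -map_comp.
have -> : P (succ_in s None) :: [seq walk_tgt s P i | i <- s'] = [seq P (succ_in s o) | o
  <- None :: map Some s'].
  by rewrite /= -map_comp.
apply/eqP/forallP => [/eq_in_map E o|E]; last by apply: eq_map => o; apply/eqP.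
apply/eqP/E; case: o => [i|]; last by rewrite mem_head.
by rewrite inE /=; apply: map_f.
Qed.

(** Each choice of letters determines a walk along s, and is determined by it together
with k and h subject to the edge equations. *)
Lemma nested_corr_sum s s' : uniq s -> (forall i, i \in s) ->
  nested_corr s s' = \sum_(P : {ffun option I -> G})
    edge_sum (walk_src P) (walk_tgt s P) (P (succ_in s None)) s s'.
Proof.
move=> us sI; rewrite /nested_corr.
(* The walk along s of the inner words. *)
pose data (k h : {ffun I -> G}) v : {ffun option I -> G} :=
  [ffun o => if o is Some i then nested_val k h v (take (index i s) s) else nested_val k h v s].
have dataP (k h : {ffun I -> G}) v (P : {ffun option I -> G}) : (data k h v == P) =
    (v == P (succ_in s None)) && [forall i, walk_tgt s P i == k i * walk_src P i * h i]%g.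
  have cP : chain (walk_src P) (walk_tgt s P) (P None) (P (succ_in s None)) s.
    by rewrite chain_walk //; apply/forallP.
  apply/eqP/andP => [PE|[/eqP -> /forallP uE]].
    have := nested_val_scan k h v us; rewrite /chain.
    have -> : [seq nested_val k h v (take (index i s) s) | i <- s] = [seq walk_src P i | i
      <- s].
      by apply: eq_map => i; rewrite /walk_src -PE ffunE.
    have -> : nested_val k h v s = P None by rewrite -PE ffunE.
    rewrite (eqP cP) eqseq_cons => /andP[/eqP xv /eqP/eq_in_map E]; split; first by rewrite xv.
    by apply/forallP => i; rewrite (E i (sI i)) /walk_src -PE ffunE.
  have {}uE i : (walk_tgt s P i = k i * walk_src P i * h i)%g by apply/eqP.
  apply/ffunP => -[i|]; rewrite ffunE; last exact: (nested_val_chain_end uE cP).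
  have [p1 [p2 sE]] : exists p1 p2, s = p1 ++ i :: p2.
    by case/splitPr: (sI i) => p1 p2; exists p1, p2.
  have ip1 : i \notin p1.
    by move: us; rewrite sE cat_uniq /= negb_or => /and3P[_ /andP[]].
  have -> : take (index i s) s = p1.
    by rewrite sE index_cat (negPf ip1) /= eqxx addn0 take_size_cat.
  rewrite {3}sE in cP; rewrite (nested_val_chain uE cP).
  by have := chain_cat cP; rewrite chain_cons => /andP[/eqP <-].
rewrite (pair_big_dep xpredT _ (fun (kh : labels) v => nested_coef kh.1 kh.2 v s s')) /=.
rewrite (partition_big (fun q => data q.1.1 q.1.2 q.2) xpredT) //=.
apply: eq_bigr => P _; rewrite /edge_sum.
under eq_bigl do rewrite dataP.
rewrite -(pair_big_dep xpredT (fun (kh : labels) v =>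
  (nested_val kh.1 kh.2 v s == nested_val kh.1 kh.2 v s') && ((v == P (succ_in s None)) &&
   [forall i, walk_tgt s P i == kh.1 i * walk_src P i * kh.2 i]%g)) (fun kh v =>
     nested_coef kh.1 kh.2 v s s')) /=.
rewrite [RHS]big_mkcond; apply: eq_bigr => kh _.
rewrite (eq_bigl (fun v => (v == P (succ_in s None)) &&
  ([forall i, walk_tgt s P i == kh.1 i * walk_src P i * kh.2 i]%g && (nested_val kh.1 kh.2
    v s == nested_val kh.1 kh.2 v s')))); last first.
  by move=> v; rewrite andbC andbA.
by rewrite big_mkcondr big_pred1_eq.
Qed.

Lemma nested_corr_int s s' : uniq s -> perm_eq s s' -> (forall i, i \in s) ->
  exists2 z : int, z%:~R = nested_corr s s' & `|z| <= (#|G| ^ #|I| *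
    #|[set P : {ffun option I -> G} | [forall o, P (succ_in s' o) == P (succ_in s o)]]%SET|)%:R.
Proof.
move=> us ss' sI; have us' : uniq s' by rewrite -(perm_uniq ss').
have s'I i : i \in s' by rewrite -(perm_mem ss').
pose Eul (P : {ffun option I -> G}) := [forall o, P (succ_in s' o) == P (succ_in s o)].
have zP (P : {ffun option I -> G}) : exists z : int,
    z%:~R = edge_sum (walk_src P) (walk_tgt s P) (P (succ_in s None)) s s' /\
    `|z| <= if Eul P then (#|G| ^ #|I|)%:R else 0.
  have cP : chain (walk_src P) (walk_tgt s P) (P None) (P (succ_in s None)) s.
    by rewrite chain_walk //; apply/forallP.
  rewrite /Eul -chain_walk //; case: ifPn => cs'.
    by have [z zE zle] := edge_sum_int us ss' cP cs'; exists z.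
  by exists 0; rewrite (edge_sum_chain us ss' cP cs') normr0.
have {zP}[z zP] := choice zP.
exists (\sum_P z P).
  by rewrite rmorph_sum nested_corr_sum //; apply: eq_bigr => P _; case: (zP P).
apply: (le_trans (ler_norm_sum _ _ _)); rewrite cardsE -sum1_card big_distrr /=.
rewrite natr_sum [leRHS]big_mkcond; apply: ler_sum => P _.
by have [_] := zP P; rewrite muln1.
Qed.

End NestedWords.

(** * Codimension bounds *)

Section Codimension.
Context (n : nat).
Hypothesis n_gt0 : (0 < n)%N.
Implicit Types (f : free_algebra F) (sigma tau : {perm 'I_n}).

Notation mperm sigma := (mword (order_of sigma)).
Notation cf f sigma := (mcoeff (mperm sigma) f).

Lemma order_neq0 sigma : order_of sigma != [::].
Proof. by rewrite -size_eq0 size_order -lt0n. Qed.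

Lemma perm_order2 sigma tau : perm_eq (order_of sigma) (order_of tau).
Proof. by apply: perm_trans (perm_order sigma) _; rewrite perm_sym perm_order. Qed.

Lemma AG_sum (T : finType) (P : pred T) g (c : T -> F) (a : T -> A) :
  (forall t, P t -> AG g (a t)) -> AG g (\sum_(t | P t) c t *: a t).
Proof.
move=> ha; elim/big_rec: _ => [|t x Pt hx]; first exact: grading0 gradA g.
exact: (grading_lin gradA _ (ha t Pt) hx).
Qed.

(** Uniqueness of the decomposition of 0. *)
Lemma grading_sum0 (c : G -> A) : (forall g, AG g (c g)) -> \sum_g c g = 0 ->
  forall g, c g = 0.
Proof.
move=> hc c0 g; have [c' [_ uniq_c]] := grading_direct gradA 0.
have E (d : G -> A) : (forall g, AG g (d g)) -> \sum_g d g = 0 -> c' = finfun d.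
  move=> hd d0; apply: uniq_c; split=> [k|]; first by rewrite ffunE.
  by rewrite -[LHS]d0; apply: eq_bigr => k _; rewrite ffunE.
have : c' = finfun (fun=> 0) by apply: E => [k|]; [exact: grading0 gradA k|exact: big1].
by rewrite (E c hc c0) => /ffunP/(_ g); rewrite !ffunE.
Qed.

Lemma AG_word (h : 'I_n -> G) (a : 'I_n -> A) sigma : assigned h a ->
  AG (\prod_(i <- order_of sigma) h i)%g (mulseq mul (map a (order_of sigma))).
Proof.
move=> ha; apply: (homw_mulseq); last exact: homw_map.
by rewrite -size_eq0 size_map size_eq0 order_neq0.
Qed.

Lemma reorder_coef_word (h : 'I_n -> G) (a : 'I_n -> A) sigma tau : assigned h a ->
  (\prod_(i <- order_of sigma) h i = \prod_(i <- order_of tau) h i)%g ->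
  mulseq mul (map a (order_of sigma)) =
  reorder_coef h (order_of sigma) (order_of tau) *: mulseq mul (map a (order_of tau)).
Proof.
move=> ha dd; have cP := reorder_coefP (order_neq0 sigma) (perm_order2 sigma tau) dd.
exact: cP.
Qed.

(** Evaluate on homogeneous elements of degrees h for which the monomial tau does not
vanish, and take the component of its degree. *)
Lemma Id_component f (h : 'I_n -> G) tau : Pmul n f -> Id mul f ->
  \sum_(sigma | (\prod_(i <- order_of sigma) h i == \prod_(i <- order_of tau) h i)%g)
    cf f sigma * reorder_coef h (order_of sigma) (order_of tau) = 0.
Proof.
move=> Pf /(Id_PmulP mul n_gt0 Pf) If.
have [a [ha a0]] := nonvanishing h (order_uniq tau) (order_neq0 tau).
pose c g := \sum_(sigma | (\prod_(i <- order_of sigma) h i)%g == g)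
  cf f sigma *: mulseq mul (map a (order_of sigma)).
have c0 : c (\prod_(i <- order_of tau) h i)%g = 0.
  apply: grading_sum0 => [g|].
    by apply: AG_sum => sigma /eqP <-; exact: AG_word.
  by rewrite -[RHS](If a) (partition_big (fun sigma => \prod_(i <- order_of sigma) h i)%g
    xpredT).
apply/eqP; move/eqP: c0; rewrite /c (eq_bigr (fun sigma => (cf f sigma *
    reorder_coef h (order_of sigma) (order_of tau)) *: mulseq mul (map a (order_of tau))));
      last first.
  by move=> sigma /eqP dd; rewrite (reorder_coef_word ha dd) scalerA.
by rewrite -scaler_suml scaler_eq0 (negPf a0) orbF.
Qed.

Definition pairing tau f : F :=
  \sum_sigma cf f sigma * corr (order_of sigma) (order_of tau).

Lemma pairing_Id tau f : Pmul n f -> Id mul f -> pairing tau f = 0.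
Proof.
move=> Pf If; rewrite /pairing.
under eq_bigr do rewrite mulr_sumr big_mkcond.
rewrite exchange_big big1 // => h _; rewrite -big_mkcond.
exact: Id_component.
Qed.

Lemma pairing_mperm tau sigma : pairing tau (mkmalgU (mperm sigma) 1) =
  corr (order_of sigma) (order_of tau).
Proof.
rewrite /pairing (bigD1 sigma) //= mcoeffUU mul1r big1 ?addr0 // => rho rs.
by rewrite mcoeffU; case: eqP => [/mperm_inj/esym/eqP|]; rewrite ?(negPf rs) ?mul0r.
Qed.

Lemma pairing_sum tau f (T : finType) (c : T -> F) (b : T -> free_algebra F) :
  pairing tau (f - \sum_t c t *: b t) = pairing tau f - \sum_t c t * pairing tau (b t).
Proof.
under [in RHS]eq_bigr do rewrite mulr_sumr.
rewrite exchange_big -sumrB; apply: eq_bigr => sigma _.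
rewrite mcoeffB (raddf_sum (mcoeff (mperm sigma))) mulrBl mulr_suml /=.
by congr (_ - _); apply: eq_bigr => t _; rewrite [X in X * _]mcoeffZ mulrA.
Qed.

(** The pairing with a column of L vanishes on identities, hence is determined by
coordinates in the quotient of P_n by the identities. *)
Lemma corr_factor : exists (x : {perm 'I_n} -> 'I_(codim mul n) -> F)
    (y : 'I_(codim mul n) -> {perm 'I_n} -> F),
  forall sigma tau, corr (order_of sigma) (order_of tau) = \sum_i x sigma i * y i tau.
Proof.
have [b Pb spanb] := codimP mul n.
have /choice[x xP] sigma : exists c : {ffun 'I_(codim mul n) -> F},
    (Pmul n `&` Id mul) (mkmalgU (mperm sigma) 1 - \sum_i c i *: b i).
  by have [c [cP _]] := spanb _ (@Pmul_mperm F n sigma); exists c.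
exists x, (fun i tau => pairing tau (b i)) => sigma tau.
have [Pf If] := xP sigma; have := pairing_Id tau Pf If.
by rewrite pairing_sum pairing_mperm => /eqP; rewrite subr_eq0 => /eqP.
Qed.

(** The letter j occurs exactly once, so the product is additive in it. *)
Lemma mulseq_linear (a : 'I_n -> A) (j : 'I_n) s (T : finType) (c : T -> A) :
  uniq s -> j \in s -> a j = \sum_t c t ->
  mulseq mul (map a s) =
  \sum_t mulseq mul (map (fun i => if i == j then c t else a i) s).
Proof.
move=> us js aj; case/splitPr: js us => p q us.
have [jp jq] : j \notin p /\ j \notin q.
  by move: us; rewrite cat_uniq /= negb_or => /and3P[_ /andP[-> _] /andP[-> _]].
have updE t r : j \notin r -> map (fun i => if i == j then c t else a i) r = map a r.
  by move=> jr; apply/eq_in_map => i ir; case: eqP ir jr => // -> ->.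
have foldl0 w : foldl mul 0 w = 0.
  by have := foldl_mulZ 0 0 w; rewrite !scale0r.
have foldl_sum w (f : T -> A) : foldl mul (\sum_t f t) w = \sum_t foldl mul (f t) w.
  elim/big_ind2: _ => [|x x' y y' <- <-|//]; first exact: foldl0.
  exact: foldl_mulD.
under eq_bigr do rewrite map_cat /= eqxx !updE //.
rewrite map_cat /= aj; case: (map a p) => [|x w] /=; first exact: foldl_sum.
rewrite foldl_cat /= linear_sum /= foldl_sum.
by apply: eq_bigr => t _; rewrite foldl_cat.
Qed.

(** Decompose the variables into homogeneous components one at a time; the induction
is on the number of variables not yet decomposed. *)
Lemma vanish_of_homogeneous (alpha : {perm 'I_n} -> F) :
  (forall (h : 'I_n -> G) a, assigned h a ->
     \sum_sigma alpha sigma *: mulseq mul (map a (order_of sigma)) = 0) ->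
  forall a : 'I_n -> A, \sum_sigma alpha sigma *: mulseq mul (map a (order_of sigma)) = 0.
Proof.
move=> hom0; suff gen m : forall a : 'I_n -> A,
    (forall i : 'I_n, (m <= i)%N -> exists g, AG g (a i)) ->
    \sum_sigma alpha sigma *: mulseq mul (map a (order_of sigma)) = 0.
  by move=> a; apply: (gen n) => i; rewrite leqNgt ltn_ord.
elim: m => [|m IHm] a ha.
  have /choice[h hh] i : exists g, AG g (a i) by exact: ha.
  exact: hom0 hh.
have [lemn|ltmn] := leqP n m.
  apply: IHm => i mi; have := leq_trans lemn mi; by rewrite leqNgt ltn_ord.
pose j := Ordinal ltmn.
have [c [[hc aj] _]] := grading_direct gradA (a j).
under eq_bigr => sigma _ do rewrite (mulseq_linear (order_uniq sigma) (mem_order sigma j)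
  aj) scaler_sumr.
rewrite exchange_big big1 // => g _; apply: IHm => i.
case: eqP => [_ _|ij mi]; first by exists g.
apply: ha; rewrite ltn_neqAle mi andbT; apply/eqP => mi'; apply: ij; exact: val_inj.
Qed.

Definition rep_order (hg : {ffun 'I_n -> G} * G) : option {perm 'I_n} :=
  [pick tau | (\prod_(i <- order_of tau) hg.1 i)%g == hg.2].

(** The linear forms cutting out the identities: the coefficient of the component of
degree hg.2 in terms of a chosen monomial of that degree, if there is one. *)
Definition component (sigma : {perm 'I_n}) (hg : {ffun 'I_n -> G} * G) : F :=
  if rep_order hg is Some tau then
    if (\prod_(i <- order_of sigma) hg.1 i)%g == hg.2 then
      reorder_coef hg.1 (order_of sigma) (order_of tau) else 0 else 0.

Lemma Id_of_components f : Pmul n f ->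
  (forall hg, \sum_sigma cf f sigma * component sigma hg = 0) -> Id mul f.
Proof.
move=> Pf f0; apply/(Id_PmulP mul n_gt0 Pf).
apply: vanish_of_homogeneous => h a ha.
rewrite (partition_big (fun sigma => \prod_(i <- order_of sigma) h i)%g xpredT) //=.
apply: big1 => g _.
have := f0 ([ffun i => h i], g); rewrite /component /rep_order.
have prodE sigma : (\prod_(i <- order_of sigma) [ffun i => h i] i = \prod_(i <- order_of
  sigma) h i)%g.
  by apply: eq_bigr => i _; rewrite ffunE.
case: pickP => [tau|none _]; last first.
  by rewrite big_pred0 // => sigma; have := none sigma; rewrite /= prodE.
rewrite /= prodE => /eqP tg cf0.
have cf0' : \sum_(sigma | (\prod_(i <- order_of sigma) h i)%g == g)
    cf f sigma * reorder_coef h (order_of sigma) (order_of tau) = 0.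
  rewrite -[RHS]cf0 [LHS]big_mkcond; apply: eq_bigr => sigma _; rewrite prodE.
  case: eqP => _; last by rewrite mulr0.
  by congr (_ * reorder_coef _ _ _); apply/funext => i; rewrite ffunE.
rewrite -[RHS](scale0r (mulseq mul (map a (order_of tau)))) -cf0'.
rewrite scaler_suml; apply: eq_bigr => sigma /eqP sg.
by rewrite (@reorder_coef_word h a sigma tau) ?scalerA // sg tg.
Qed.

Lemma codim_le : (codim mul n <= #|G| ^ n.+1)%N.
Proof.
rewrite leqNgt; apply/negP => lt.
have [b Pb spanb] := codimP mul n.
have cardK : #|{: {ffun 'I_n -> G} * G}| = (#|G| ^ n.+1)%N.
  by rewrite card_prod card_ffun card_ord expnSr.
have [|c [i0 ci0] c0] := @dependent_rows F 'I_(codim mul n) ({ffun 'I_n -> G} * G)%type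
  (fun i hg => \sum_sigma cf (b i) sigma * component sigma hg).
  by rewrite cardK card_ord.
have Psum : Pmul n (\sum_i c i *: b i) by exact: Pmul_sum.
have Isum : Id mul (\sum_i c i *: b i).
  apply: Id_of_components => // hg; rewrite -[RHS](c0 hg).
  under [RHS]eq_bigr do rewrite mulr_sumr.
  rewrite exchange_big; apply: eq_bigr => sigma _.
  rewrite (raddf_sum (mcoeff (mperm sigma))) mulr_suml; apply: eq_bigr => i _ /=.
  by rewrite [X in X * _]mcoeffZ mulrA.
have [d [_ duniq]] := spanb 0 (@Pmul0 F n).
have d0 : d = [ffun=> 0].
  apply: duniq; rewrite big1 => [|i _]; last by rewrite ffunE scale0r.
  rewrite subr0; split; first exact: Pmul0.
  by split=> [|rho]; [rewrite mcoeff0|exact: evalp0].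
have dc : d = [ffun i => - c i].
  apply: duniq; rewrite sub0r -sumrN.
  by under eq_bigr do rewrite ffunE scaleNr opprK.
by move: dc ci0; rewrite d0 => /ffunP/(_ i0); rewrite !ffunE => /esym/eqP; rewrite oppr_eq0
  => ->.
Qed.

Lemma exists_identity : (#|G| ^ n.+1 < n`!)%N -> is_PI mul.
Proof.
move=> lt; have [|c [s0 cs0] c0] := @dependent_rows F {perm 'I_n} ({ffun 'I_n -> G} *
  G)%type component.
  by rewrite card_prod card_ffun card_ord -expnSr card_Sn.
pose f : free_algebra F := \sum_sigma c sigma *: mkmalgU (mperm sigma) 1.
have cfE sigma : cf f sigma = c sigma.
  rewrite (raddf_sum (mcoeff (mperm sigma))) (bigD1 sigma) //=.
  rewrite [X in X + _]mcoeffZ mcoeffUU mulr1 big1 ?addr0 // => tau ts.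
  rewrite [LHS]mcoeffZ mcoeffU; case: eqP => [/mperm_inj/eqP|]; last by rewrite mulr0.
  by rewrite (negPf ts).
exists f.
  by apply: contra cs0 => /eqP f0; rewrite -cfE f0 mcoeff0.
apply: Id_of_components => [|hg]; first by apply: Pmul_sum => sigma; exact: Pmul_mperm.
by rewrite -[RHS](c0 hg); apply: eq_bigr => sigma _; rewrite cfE.
Qed.

Hypothesis charF : [pchar F] =i pred0.

Lemma intr_inj_pchar (a b : int) : a%:~R = b%:~R :> F -> a = b.
Proof.
move=> ab; apply/eqP; rewrite -subr_eq0; apply: contraT => /(intr_neq0_pchar charF).
by rewrite rmorphB /= ab subrr eqxx.
Qed.

Lemma corr_refl sigma : corr (order_of sigma) (order_of sigma) = (#|G| ^ n)%:R.
Proof.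
rewrite /corr (eq_bigl xpredT) => [|h]; last by rewrite eqxx.
rewrite (eq_bigr (fun=> 1)) => [|h _].
  by rewrite sumr_const card_ffun card_ord.
by rewrite (reorder_coef_refl) ?order_uniq // (order_neq0).
Qed.

(** Walks that both orders follow with the same edges (see [chain_walk]). *)
Definition common_walks sigma tau : nat :=
  #|[set P : {ffun option 'I_n -> G} |
      [forall o, P (succ_in (order_of tau) o) == P (succ_in (order_of sigma) o)]]%SET|.

(** Two walks in G are one walk in G * G, to which [sum_card_successor] applies. *)
Lemma sum_common_walks sigma :
  (\sum_tau common_walks sigma tau ^ 2 <= n.+1`! * n.+2 ^ (#|G| ^ 2))%N.
Proof.
have := sum_card_successor (G * G)%type (order_uniq sigma).
rewrite card_prod card_ord -mulnn => /(leq_trans _); apply.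
apply: leq_sum => tau _; rewrite -mulnn /common_walks.
set S := (X in (#|X| * _)%N); rewrite -cardsX.
pose f (PQ : {ffun option 'I_n -> G} * {ffun option 'I_n -> G}) : {ffun option 'I_n -> G * G} :=
  [ffun o => (PQ.1 o, PQ.2 o)].
have fI : injective f.
  move=> [P Q] [P' Q'] /ffunP E; congr (_, _); apply/ffunP => o; by have := E o; rewrite
    !ffunE => -[].
rewrite -(card_imset _ fI); apply: subset_leq_card; apply/fintype.subsetP => R /imsetP[[P Q]].
rewrite !inE /= => /andP[/forallP EP /forallP EQ] ->.
by apply/forallP => o; rewrite !ffunE /= (eqP (EP o)) (eqP (EQ o)).
Qed.

(** Here N stands for n!, which cancels from the second moment estimate. *)
Lemma cancel_factorials (N g m d W : nat) : (0 < N)%N -> (0 < g)%N ->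
  ((g ^ (2 * m).+1 * N) ^ 2 <= d ^ 2 * (((g ^ m) ^ 2 * (m.+1 * N * W)) * N))%N ->
  (g ^ (2 * m) <= d ^ 2 * (m.+2 * W))%N.
Proof.
move=> N0 g0; set a := (g ^ m)%N; have a0 : (0 < a)%N by rewrite expn_gt0 g0.
have gE : (g ^ (2 * m) = a ^ 2)%N by rewrite /a -expnM mulnC.
have -> : (g ^ (2 * m).+1 = a ^ 2 * g)%N by rewrite expnSr gE.
rewrite gE.
have -> : ((a ^ 2 * g * N) ^ 2 = N ^ 2 * a ^ 2 * (a ^ 2 * g ^ 2))%N by ring.
have -> : (d ^ 2 * ((a ^ 2 * (m.+1 * N * W)) * N) = N ^ 2 * a ^ 2 * (d ^ 2 * (m.+1 * W)))%N.
  by ring.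
rewrite leq_pmul2l => [le|]; last by rewrite muln_gt0 !expn_gt0 N0 g0.
apply: (@leq_trans (a ^ 2 * g ^ 2)); first by rewrite leq_pmulr // expn_gt0 g0.
by apply: (leq_trans le); rewrite leq_mul2l leq_mul2r leqnSn !orbT.
Qed.

Lemma codim_ge : (#|G| ^ (2 * n) <= codim mul n ^ 2 * n.+2 ^ (#|G| ^ 2).+1)%N.
Proof.
have [x [y xy]] := corr_factor .
(* r sigma lists the variables in the reverse order. *)
have /choice[r rE] sigma : exists tau, rev (order_of sigma) = order_of tau.
  by apply: perm_enumP; rewrite perm_rev perm_order.
have /choice[z0 zP] (st : {perm 'I_n} * {perm 'I_n}) : exists z : int,
    z%:~R = nested_corr (order_of st.1) (order_of st.2) /\
    `|z| <= (#|G| ^ n * common_walks st.1 st.2)%:R.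
  have [z zE zle] := nested_corr_int (order_uniq st.1)
    (perm_order2 st.1 st.2) (mem_order st.1).
  by exists z; rewrite card_ord in zle.
pose z sigma tau := z0 (sigma, tau).
have zE sigma tau : (z sigma tau)%:~R =
    \sum_(ij : 'I_(codim mul n) * 'I_(codim mul n))
      (#|G|%:R * (x (r sigma) ij.1 * x sigma ij.2)) * (y ij.1 (r tau) * y ij.2 tau).
  have [-> _] := zP (sigma, tau).
  rewrite (nested_corr_factor) ?order_uniq ?order_neq0 ?perm_order2 //.
  rewrite !rE !xy -(pair_bigA _ (fun i j => (#|G|%:R * (x (r sigma) i * x sigma j)) * (y i
    (r tau) * y j tau))) /=.
  rewrite mulr_suml mulr_sumr; apply: eq_bigr => i _.
  rewrite !mulr_sumr; apply: eq_bigr => j _.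
  by rewrite -!mulrA; congr (_ * (_ * _)); rewrite mulrCA.
have ztr sigma : z sigma sigma = (#|G| ^ (2 * n).+1)%:R.
  apply: intr_inj_pchar; rewrite rmorph_nat; have [-> _] := zP (sigma, sigma).
  rewrite (nested_corr_factor) ?order_uniq ?order_neq0 //= rE !corr_refl -!natrM.
  by rewrite -expnD addnn -mul2n -expnS.
have := sqr_trace_le_factor charF zE.
rewrite card_prod card_ord mulnn.
under eq_bigr do rewrite ztr.
have sz sigma : \sum_tau z sigma tau ^+ 2 <= ((#|G| ^ n) ^ 2 * (n.+1`! * n.+2 ^ (#|G| ^ 2)))%:R.
  apply: (@le_trans _ _ (\sum_tau ((#|G| ^ n * common_walks sigma tau) ^ 2)%:R)).
    apply: ler_sum => tau _; have [_ zle] := zP (sigma, tau).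
    by rewrite -real_normK ?num_real // natrX lerXn2r ?nnegrE.
  rewrite -natr_sum ler_nat (eq_bigr (fun tau => (#|G| ^ n) ^ 2 * common_walks sigma tau ^
    2)%N).
    by rewrite -big_distrr leq_mul2l sum_common_walks orbT.
  by move=> tau _; rewrite expnMn.
move=> /le_trans/(_ (ler_wpM2l (ler0n _ _) (ler_sum _ (fun sigma _ => sz sigma)))).
rewrite !sumr_const card_Sn -!mulrnA -natrX -natrM ler_nat factS [(n.+2 ^ _.+1)%N]expnS.
by apply: cancel_factorials; [exact: fact_gt0|apply/card_gt0P; exists 1%g].
Qed.

End Codimension.
End GradedAlgebra.

(** * Exponential growth rate *)

(** From ln p < p at p = sqrt (m + 2), which is at most 2 sqrt m. *)
Lemma ln_natr_le (R : realType) (m : nat) : (0 < m)%N ->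
  m%:R^-1 * ln (m.+2%:R : R) <= 4 * Num.sqrt m%:R^-1.
Proof.
move=> m0; have m0R : 0 < m%:R :> R by rewrite ltr0n.
set q : R := Num.sqrt m%:R; set p : R := Num.sqrt m.+2%:R.
have q0 : 0 < q by rewrite sqrtr_gt0.
have p0 : 0 < p by rewrite sqrtr_gt0 ltr0n.
have pE : m.+2%:R = p ^+ 2 by rewrite sqr_sqrtr.
have qE : m%:R = q ^+ 2 by rewrite sqr_sqrtr // ltW.
have rE : Num.sqrt (m%:R^-1 : R) = q^-1 by rewrite sqrtrV // ltW.
have pq : p <= 2 * q.
  rewrite -(@ler_pXn2r _ 2) ?nnegrE ?ltW ?mulr_gt0 // exprMn -pE -qE.
  have m1 : 1 <= m%:R :> R by rewrite ler1n.
  by rewrite -addn2 natrD; lra.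
rewrite rE pE lnXn // qE; have lp := ltW (ln_sublinear p0).
have -> : 4 * q^-1 = (q ^+ 2)^-1 * (4 * q) by field; rewrite gt_eqF.
by rewrite ler_pM2l ?invr_gt0 ?exprn_gt0 // -mulr_natl; lra.
Qed.

(** On logarithms: (1/n) ln (c n) lies between ln g - b ln (n+2) / n and
ln g + ln g / n. *)
Lemma cvg_root_growth (R : realType) (c : nat -> nat) (g b : nat) : (0 < g)%N ->
  (forall n, (0 < n)%N -> (c n <= g ^ n.+1)%N) ->
  (forall n, (0 < n)%N -> (g ^ (2 * n) <= c n ^ 2 * n.+2 ^ b)%N) ->
  (c n)%:R `^ (n%:R^-1) @[n --> \oo] --> (g%:R : R).
Proof.
move=> g0 cle cge; have g0R : 0 < g%:R :> R by rewrite ltr0n.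
rewrite -cvg_shiftS /=.
have c0 n : (0 < c n.+1)%N.
  rewrite lt0n; apply/eqP => cn; have := cge n.+1 isT.
  by rewrite cn leqn0 expn_eq0 => /andP[/eqP gE]; rewrite gE in g0.
have c0R n : 0 < (c n.+1)%:R :> R by rewrite ltr0n.
have -> : (fun n => (c n.+1)%:R `^ (n.+1%:R^-1)) = (fun n => expR (n.+1%:R^-1 * ln ((c
  n.+1)%:R : R))).
  by apply/funext => n; rewrite /powR gt_eqF.
have <- : expR (ln g%:R) = g%:R :> R by rewrite lnK ?posrE.
apply: (@continuous_cvg _ _ _ _ _ _ expR); first exact: continuous_expR.
have cvgs : Num.sqrt (harmonic n : R) @[n --> \oo] --> 0.
  have : Num.sqrt (harmonic n : R) @[n --> \oo] --> Num.sqrt (0 : R).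
    by apply: continuous_cvg; [exact: sqrt_continuous|exact: cvg_harmonic].
  by rewrite sqrtr0.
have lnc n : n.+1%:R * ln (g%:R : R) - b%:R * ln n.+3%:R <= ln ((c n.+1)%:R : R) <= n.+2%:R
  * ln g%:R.
  have lX x (m : nat) : 0 < x -> m%:R * ln x = ln (x ^+ m) :> R by move=> x0; rewrite lnXn
    // mulr_natl.
  apply/andP; split; last first.
    by rewrite lX // ler_ln ?posrE ?exprn_gt0 // -natrX ler_nat cle.
  rewrite lerBlDr !lX ?ltr0n // -lnM ?posrE ?exprn_gt0 ?ltr0n // ler_ln ?posrE ?mulr_gt0
    ?exprn_gt0 ?ltr0n //.
  rewrite -!natrX -natrM ler_nat -(leq_exp2r _ _ (isT : (0 < 2)%N)) -expnM mulnC.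
  apply: (leq_trans (cge n.+1 isT)); rewrite expnMn leq_mul2l; apply/orP; right.
  by rewrite -expnM leq_pexp2l //; lia.
apply: (squeeze_cvgr (f := fun n => ln g%:R - b%:R * (4 * Num.sqrt (harmonic n : R)))
   (h := fun n => ln g%:R + ln g%:R * (harmonic n : R))).
- apply: nearW => n; have m0 : 0 < n.+1%:R :> R by rewrite ltr0n.
  have /andP[l1 l2] := lnc n; have l3 := @ln_natr_le R n.+1 isT.
  rewrite ![n.+1%:R^-1 * _]mulrC ler_pdivrMr // ler_pdivlMr // /harmonic.
  apply/andP; split.
    apply: le_trans l1; rewrite mulrBl [_ * n.+1%:R]mulrC lerD2l lerN2 -mulrA ler_wpM2l //.
    by rewrite -ler_pdivrMr // mulrC.
  apply: (le_trans l2); rewrite -[n.+2%:R]natr1 mulrDl mul1r.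
  by rewrite /= mulrDl (mulrC _ n.+1%:R) lerD2l -mulrA mulVf ?gt_eqF // mulr1.
- have : ln g%:R - b%:R * (4 * Num.sqrt (harmonic n : R)) @[n --> \oo] -->
      ln g%:R - b%:R * (4 * 0).
    by apply: cvgB; [exact: cvg_cst|apply: cvgMr; apply: cvgMr].
  by rewrite !mulr0 subr0.
- have : ln g%:R + ln g%:R * (harmonic n : R) @[n --> \oo] --> ln g%:R + ln g%:R * 0.
    by apply: cvgD; [exact: cvg_cst|apply: cvgMr; exact: cvg_harmonic].
  by rewrite mulr0 addr0.
Qed.

Lemma leq_exp_fact (a m : nat) : (a ^ m <= (a + m)`!)%N.
Proof.
elim: m => [|m IHm]; first by rewrite expn0 fact_gt0.
by rewrite expnS addnS factS leq_mul // leqW // leq_addr.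
Qed.

Lemma exists_fact_gt_exp (g : nat) : (0 < g)%N ->
  exists2 n, (0 < n)%N & (g ^ n.+1 < n`!)%N.
Proof.
(* (2 g + m)! >= (2 g)^m = 2^m g^m, and 2^m exceeds the missing factor g^(2 g + 1). *)
move=> g0; pose m := (g ^ (2 * g).+1)%N; exists (2 * g + m)%N; first by lia.
apply: leq_trans (leq_exp_fact (2 * g) m).
rewrite expnMn -addSn expnD ltn_pmul2r ?expn_gt0 ?g0 //.
by rewrite -/m ltn_expl.
Qed.

Lemma cvg_codim_root (R : realType) (F : fieldType) (A : lmodType F)
    (mul : {bilinear A -> A -> A}) (G : finGroupType) :
  [pchar F] =i pred0 -> associative mul ->
  has_nondegenerate_regular_grading mul G ->
  codim_root mul R n @[n --> \oo] --> (#|G|%:R : R).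
Proof.
move=> charF mulA [AG [theta [gradA regA ndegA]]].
apply: (@cvg_root_growth R (codim mul) #|G| (#|G| ^ 2).+1) => [|n n0|n n0].
- by apply/card_gt0P; exists 1%g.
- exact: (codim_le gradA regA n0).
- exact: (codim_ge mulA gradA regA ndegA n0 charF).
Qed.

Theorem theorem12 (R : realType) (F : closedFieldType)
    (charF0 : [pchar F] =i pred0)
    (A : lmodType F) (mul : {bilinear A -> A -> A}) (mulA : associative mul)
    (G H : finGroupType)
    (gradG : has_nondegenerate_regular_grading mul G)
    (gradH : has_nondegenerate_regular_grading mul H) :
  [/\ #|G| = #|H|,
      cvgn (codim_root mul R),
      pi_exp mul R = #|G|%:R
    & is_PI mul].
Proof.
have cvgG := @cvg_codim_root R F A mul G charF0 mulA gradG.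
have cvgH := @cvg_codim_root R F A mul H charF0 mulA gradH.
have limG : pi_exp mul R = #|G|%:R by apply: cvg_lim cvgG.
have limH : pi_exp mul R = #|H|%:R by apply: cvg_lim cvgH.
split=> //.
- by apply/eqP; rewrite -(eqr_nat R) -limG limH.
- by apply/cvg_ex; exists #|G|%:R.
have [AG [theta [gradA regA _]]] := gradG.
have [n n0 lt] : exists2 n, (0 < n)%N & (#|G| ^ n.+1 < n`!)%N.
  by apply: exists_fact_gt_exp; apply/card_gt0P; exists 1%g.
exact: (exists_identity gradA regA n0 lt).
Qed.
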